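(* Let $G$ be a (finite simple) bipartite graph. Then the edge ring $K[G]$ is inseparable if and only if the graph $G$ is inseparable.
   Context: $K$ is a field of characteristic $0$. $G$ has vertex set $[m]=\{1,\ldots,m\}$ and edges $e_1,\ldots,e_n$. $K[G]=K[t_it_j:\{i,j\}\in E(G)]$ is the edge ring. Graph inseparability: $G$ is separable by an edge $e$ if there exist nonempty subgraphs $G_1,G_2$ of $G$ such that (1) $E(G_1)\cap E(G_2)=\{e\}$ and $V(G_1)\cap V(G_2)=e$ (as a 2-element vertex set); (2) $E(G)=E(G_1)\cup E(G_2)$ and $V(G)=V(G_1)\cup V(G_2)$; (3) $e$ is an internal edge of both $G_1$ and $G_2$, where an edge of a graph is internal if it belongs to a cycle of this graph. $G$ is inseparable if it is not separable by any edge. Inseparability of $K[G]$: with $\delta_1,\ldots,\delta_m$ the canonical basis of $\mathbb{Z}^m$ and $h_k=\delta_i+\delta_j$ for $e_k=\{i,j\}$, let $H(G)$ be the semigroup generated by $h_1,\ldots,h_n$ and $L\subset\mathbb{Z}^n$ its relation lattice, i.e. the kernel of $\mathbb{Z}^n\to\mathbb{Z}^m$, $\epsilon_k\mapsto h_k$. $K[G]$ is inseparable if $L$ is inseparable in the following sense. For $v\in\mathbb{Z}^n$ put $f_v=\prod_{v(i)\ge0}x_i^{v(i)}-\prod_{v(i)\le0}x_i^{-v(i)}$ in $S=K[x_1,\ldots,x_n]$; for a lattice $L$, $I_L=(f_v:v\in L)$; $L$ is saturated if $\mathbb{Z}^n/L$ is torsionfree. Let $\pi_i:S[x_{n+1}]\to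 S$ be the $K$-algebra map with $\pi_i(x_j)=x_j$ ($j\le n$), $\pi_i(x_{n+1})=x_i$. A saturated $L\subset\mathbb{Z}^n$ is $i$-separable if there is a saturated $L'\subset\mathbb{Z}^{n+1}$ such that (i) $\operatorname{rank}L'=\operatorname{rank}L$; (ii) $\pi_i(I_{L'})=I_L$; (iii) there is a minimal system of generators $f_{w_1},\ldots,f_{w_s}$ of $I_{L'}$ such that $(w_1(n+1),\ldots,w_s(n+1))$ and $(w_1(i),\ldots,w_s(i))$ are linearly independent. $L$ is inseparable if it is not $i$-separable for any $i\in\{1,\ldots,n\}$. *)

(* Defs.v *)
From HB Require Import structures.
From mathcomp Require Import all_boot all_order all_algebra.
From mathcomp Require Import mpoly.

Set Implicit Arguments.
Unset Strict Implicit.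
Unset Printing Implicit Defensive.

Import GRing.Theory.
Local Open Scope ring_scope.

Record sgraph (T : finType) := SGraph {
  vset : {set T};
  eset : {set {set T}};
  esetP : forall e, e \in eset -> (e \subset vset) && (#|e| == 2)
}.

Section Graphs.
Variable T : finType.
Implicit Types (G : sgraph T) (e : {set T}).

Definition subgraph G1 G := vset G1 \subset vset G /\ eset G1 \subset eset G.

Definition adj G : rel T := fun x y => [set x; y] \in eset G.

Definition bipartite G := exists A B : {set T},
  [/\ A :|: B = vset G, [disjoint A & B] &
      forall e, e \in eset G ->
        exists x y, [/\ x \in A, y \in B & e = [set x; y]]].

(* The bound on [size c] excludes walking back and forth along one edge. *)
Definition internal G e := exists c : seq T,
  [/\ (2 < size c)%N, ucycle (adj G) c &
      exists2 x, x \in c & e = [set x; next c x]].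

Definition separable_by G e := exists G1 G2 : sgraph T,
  [/\ [/\ subgraph G1 G, subgraph G2 G, vset G1 != set0 & vset G2 != set0],
      eset G1 :&: eset G2 = [set e] /\ vset G1 :&: vset G2 = e,
      eset G = eset G1 :|: eset G2 /\ vset G = vset G1 :|: vset G2 &
      internal G1 e /\ internal G2 e].

Definition graph_inseparable G :=
  forall e, e \in eset G -> ~ separable_by G e.

End Graphs.

Section Ideals.
Variable R : comNzRingType.

Definition ideal_gen (P : R -> Prop) (p : R) := exists s : seq (R * R),
  (forall u, u \in s -> P u.2) /\ p = \sum_(u <- s) u.1 * u.2.

Definition generates s (f : 'I_s -> R) (A : {set 'I_s}) (I : R -> Prop) :=
  forall p, I p <-> ideal_gen (fun g => exists2 k, k \in A & g = f k) p.

(* Minimal means that no proper subfamily generates.  When I = I_{L'} and L'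
   contains no nonzero nonnegative vector (which the condition
   pi_i(I_{L'}) = I_L forces for the lattice L of an edge ring), the generators
   are homogeneous for a positive grading and this agrees with having the least
   number of generators. *)
Definition minimal_generators s (f : 'I_s -> R) (I : R -> Prop) :=
  generates f setT I /\ forall A, generates f A I -> A = setT.

End Ideals.

(* Linear independence over Z of the rows of an integer matrix; over an
   integral domain this is independence over the fraction field. *)
Definition rows_independent r n (B : 'M[int]_(r, n)) :=
  forall c : 'rV[int]_r, c *m B = 0 -> c = 0.

Section Lattices.
Variable n : nat.
Implicit Types (L : zmodClosed 'rV[int]_n) (v : 'rV[int]_n).

Definition saturated L :=
  forall (k : int) v, k != 0 -> k *: v \in L -> v \in L.

Definition lattice_basis L r (B : 'M[int]_(r, n)) :=
  rows_independent B /\ forall v, v \in L <-> exists c, v = c *m B.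

Definition lattice_rank L r := exists B : 'M[int]_(r, n), lattice_basis L B.

Definition lattice_binomial (K : fieldType) v : {mpoly K[n]} :=
  \prod_(i < n | 0 <= v 0 i) 'X_i ^+ absz (v 0 i)
  - \prod_(i < n | v 0 i <= 0) 'X_i ^+ absz (v 0 i).

Definition lattice_ideal (K : fieldType) L : {mpoly K[n]} -> Prop :=
  ideal_gen (fun f => exists2 v, v \in L & f = lattice_binomial K v).

End Lattices.

Arguments lattice_ideal {n} K L p.

(* The indices 0, ..., n-1 are embedded in 'I_n.+1 by [lift ord_max], and
   [ord_max] is the index of the additional variable. *)
Definition identify (K : fieldType) n (i : 'I_n) (p : {mpoly K[n.+1]}) :
    {mpoly K[n]} :=
  p \mPo [tuple 'X_(odflt i (unlift ord_max j)) | j < n.+1].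

Definition i_separable (K : fieldType) n (L : zmodClosed 'rV[int]_n)
    (i : 'I_n) :=
  exists L' : zmodClosed 'rV[int]_n.+1,
  [/\ saturated L',
      exists r, lattice_rank L' r /\ lattice_rank L r,
      forall p, lattice_ideal K L p
                <-> exists2 q, lattice_ideal K L' q & identify i q = p &
      exists s (W : 'M[int]_(s, n.+1)),
        [/\ forall k, row k W \in L',
            minimal_generators (fun k => lattice_binomial K (row k W))
              (lattice_ideal K L') &
            rows_independent
              (col_mx (col ord_max W)^T (col (lift ord_max i) W)^T)]].

Definition lattice_inseparable (K : fieldType) n (L : zmodClosed 'rV[int]_n) :=
  forall i, ~ i_separable K L i.

(* The kernel of Z^n -> Z^m, eps_k |-> row k h. *)
Definition relation_lattice n m (h : 'M[int]_(n, m)) : {pred 'rV[int]_n} :=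
  [pred v | v *m h == 0].

Fact relation_lattice_closed n m (h : 'M[int]_(n, m)) :
  zmod_closed (relation_lattice h).
Proof.
split=> [|u v]; rewrite !inE ?mul0mx // => /eqP hu /eqP hv.
by rewrite mulmxBl hu hv subr0.
Qed.

HB.instance Definition _ n m (h : 'M[int]_(n, m)) :=
  GRing.isZmodClosed.Build 'rV[int]_n (relation_lattice h)
    (relation_lattice_closed h).

Fact relation_lattice_saturated n m (h : 'M[int]_(n, m)) :
  saturated (relation_lattice h).
Proof.
move=> k v k0; rewrite !inE -scalemxAl => /eqP/matrixP kv0.
apply/eqP/matrixP=> i j; have /eqP := kv0 i j.
by rewrite !mxE mulf_eq0 (negPf k0) => /eqP.
Qed.

Definition edge_vectors n m (e : 'I_n -> {set 'I_m}) : 'M[int]_(n, m) :=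
  \matrix_(k < n) \sum_(i in e k) delta_mx 0 i.

(* [e] lists without repetition the edges of a graph with vertex set 'I_m. *)
Definition edge_enumeration n m (G : sgraph 'I_m) (e : 'I_n -> {set 'I_m}) :=
  [/\ vset G = setT, injective e & eset G = [set e k | k : 'I_n]].

(* Inseparability of K[G] is a property of its presentation by the variables
   x_1, ..., x_n indexed by the edges, hence of the relation lattice. *)
Definition edge_ring_inseparable (K : fieldType) n m
    (e : 'I_n -> {set 'I_m}) :=
  lattice_inseparable K (relation_lattice (edge_vectors e)).

(* Main.v *)
(* The lattice L consists of the circulations of G: integer edge weights whose
   sum vanishes at each vertex.

   If e = e_i = {a, b} separates G into G1 and G2, doubling e gives a lattice L'
   isomorphic to L(G1) + L(G2); because G is bipartite, L is the sum of its
   sublattices supported on G1 and on G2, so identifying the two copies of e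
   maps L' onto L.  The ideal of L' is generated by the binomials of circulations
   with entries 0, 1, -1 living on one side (signed directed cycles), and both
   copies of e have to occur in a minimal generating set.

   Conversely, let L' be an i-separation of L.  The fold map Z^(n+1) -> Z^n adding
   the new coordinate to coordinate i restricts, by comparing ranks, to an
   isomorphism L' -> L.  If v in L vanishes on all edges at a, no monomial in the
   fiber of v involves x_i, so the lift of v to L' vanishes at both copies of i;
   the same holds for b.  If e does not separate G, at most one component of
   G - {a, b} is adjacent to both a and b, and then each v in L with v(i) = 0 is
   the sum of a circulation avoiding a and one avoiding b.  Hence the new
   coordinate vanishes on every w in L' whose fold vanishes at i, so on L' the
   coordinates i and n+1 are linearly dependent. *)
From HB Require Import structures.
Require Import Defs.
From mathcomp Require Import all_boot all_order all_algebra.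
From mathcomp Require Import mpoly zify ring.
From Stdlib Require Import Classical ClassicalEpsilon.

Set Implicit Arguments.
Unset Strict Implicit.
Unset Printing Implicit Defensive.

Import Order.TTheory GRing.Theory Num.Theory.
Local Open Scope ring_scope.

(** * Ideals generated by binomials *)

Section IdealGen.
Variable R : comNzRingType.
Implicit Types (P Q : R -> Prop) (p q : R).

Lemma ideal_gen0 P : ideal_gen P 0.
Proof. by exists [::]; rewrite big_nil. Qed.

Lemma ideal_genD P p q : ideal_gen P p -> ideal_gen P q -> ideal_gen P (p + q).
Proof.
move=> [s [sP ->]] [t [tP ->]]; exists (s ++ t); rewrite big_cat; split=> // u.
by rewrite mem_cat => /orP[/sP|/tP].
Qed.

Lemma ideal_genM P p q : ideal_gen P q -> ideal_gen P (p * q).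
Proof.
move=> [s [sP ->]]; exists [seq (p * u.1, u.2) | u <- s]; split.
  by move=> _ /mapP[u /sP uP ->].
by rewrite big_map mulr_sumr; apply: eq_bigr => u _; rewrite mulrA.
Qed.

Lemma ideal_gen_mem P p : P p -> ideal_gen P p.
Proof.
move=> Pp; exists [:: (1, p)]; rewrite big_seq1 mul1r; split=> // u.
by rewrite inE => /eqP->.
Qed.

Lemma ideal_gen_sub P Q p :
  (forall q, P q -> ideal_gen Q q) -> ideal_gen P p -> ideal_gen Q p.
Proof.
move=> PQ [s [sP ->]]; elim: s sP => [|u s IHs] sP.
  by rewrite big_nil; apply: ideal_gen0.
rewrite big_cons; apply: ideal_genD; last first.
  by apply: IHs => v vs; apply: sP; rewrite inE vs orbT.
by apply/ideal_genM/PQ/sP; rewrite mem_head.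
Qed.

End IdealGen.

Section Monomials.
Variables (K : fieldType) (n : nat).
Implicit Types (p q u : 'X_{1..n}) (v : 'rV[int]_n).

(** Evaluated at the point with all coordinates 1, this gives the sum of the coefficients of [f]
    over the monomials in [C]. *)
Definition class_part (C : pred 'X_{1..n}) (f : {mpoly K[n]}) : {mpoly K[n]} :=
  \sum_(m <- msupp f) (f@_m *+ C m) *: 'X_[m].

Lemma mcoeff_class_part C f m : (class_part C f)@_m = f@_m *+ C m.
Proof.
rewrite /class_part raddf_sum /=.
under eq_bigr => k _ do rewrite mcoeffZ mcoeffX.
have [ms|ms] := boolP (m \in msupp f).
  rewrite (bigD1_seq m) //= eqxx mulr1 big1 ?addr0 // => k /negPf->.
  by rewrite mulr0.
rewrite (memN_msupp_eq0 ms) mul0rn big1_seq // => k /= ks.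
by case: eqP => [km|_]; rewrite ?mulr0 //; rewrite -km ks in ms.
Qed.

Lemma class_partD C f g :
  class_part C (f + g) = class_part C f + class_part C g.
Proof.
by apply/mpolyP => m; rewrite !(mcoeffD, mcoeff_class_part) mulrnDl.
Qed.

Lemma class_part0 C : class_part C 0 = 0.
Proof. by apply/mpolyP => m; rewrite mcoeff_class_part !mcoeff0 mul0rn. Qed.

Lemma class_part_binomial C c p q :
  class_part C (c *: ('X_[p] - 'X_[q]))
  = c *: ('X_[p] *+ C p - 'X_[q] *+ C q).
Proof.
apply/mpolyP => m; rewrite mcoeff_class_part !mcoeffZ !mcoeffB !mcoeffMn !mcoeffX.
rewrite -mulrnAr mulrnBl; congr (_ * (_ - _)).
  by case: eqP => [->|_]; rewrite ?mul0rn.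
by case: eqP => [->|_]; rewrite ?mul0rn.
Qed.

(* The sum of the coefficients over the monomials in [C] is a linear form that
   vanishes on the ideal, so it vanishes on ['X_[p] - 'X_[q]]. *)
Lemma binomial_class (P : {mpoly K[n]} -> Prop) (C : 'X_{1..n} -> Prop) p q :
  (forall f, P f -> exists a b, f = 'X_[a] - 'X_[b] /\
     forall u, C (u + a)%MM <-> C (u + b)%MM) ->
  ideal_gen P ('X_[p] - 'X_[q]) -> C p -> C q.
Proof.
move=> PC [s [sP pq]] Cp.
pose D m : bool := if excluded_middle_informative (C m) then true else false.
have DP m : reflect (C m) (D m).
  by rewrite /D; case: excluded_middle_informative => ?; constructor.
pose F f := (class_part D f).@[fun=> 1].
have FD f g : F (f + g) = F f + F g by rewrite /F class_partD mevalD.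
have F0 : F 0 = 0 by rewrite /F class_part0 meval0.
have FX c a b : F (c *: ('X_[a] - 'X_[b])) = c * ((D a)%:R - (D b)%:R).
  rewrite /F class_part_binomial mevalZ mevalB !mevalMn !mevalX.
  by rewrite !big1 // => i _; rewrite expr1n.
(* By linearity only monomial multiples of a generator matter, and [C] contains both or neither of
   their two terms. *)
have F1 f : P f -> forall g, F (g * f) = 0.
  move=> /PC[a [b [-> ab]]]; apply: mpolyind => [|c m g _ _ IHg].
    by rewrite mul0r.
  rewrite mulrDl FD IHg addr0 -scalerAl mulrBr -!mpolyXD FX.
  have -> : D (m + a)%MM = D (m + b)%MM by apply/DP/DP => /ab.
  by rewrite subrr mulr0.
have : F ('X_[p] - 'X_[q]) = 0.
  rewrite pq {pq}; elim: s sP => [|u s IHs] sP; first by rewrite big_nil.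
  rewrite big_cons FD F1 ?add0r; last by apply: sP; rewrite mem_head.
  by apply: IHs => v vs; apply: sP; rewrite inE vs orbT.
rewrite -[_ - _]scale1r FX mul1r; have /DP-> := Cp.
case: DP => // _ /eqP; by rewrite subr0 oner_eq0.
Qed.

Definition posm v : 'X_{1..n} :=
  [multinom (if 0 <= v 0 i then absz (v 0 i) else 0%N)%R | i < n].
Definition negm v : 'X_{1..n} :=
  [multinom (if v 0 i <= 0 then absz (v 0 i) else 0%N)%R | i < n].
Definition mdiff p q : 'rV[int]_n := \row_i ((p i)%:Z - (q i)%:Z).

Lemma mdiff_posm_negm v : mdiff (posm v) (negm v) = v.
Proof. by apply/rowP => i; rewrite mxE !mnmE; do 2![case: ifP]; lia. Qed.

Lemma lattice_binomialE v : lattice_binomial K v = 'X_[posm v] - 'X_[negm v].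
Proof.
rewrite /lattice_binomial !mpolyXE_id; congr (_ - _).
  rewrite big_mkcond; apply: eq_bigr => i _; rewrite mnmE.
  by case: ifP.
rewrite big_mkcond; apply: eq_bigr => i _; rewrite mnmE.
by case: ifP.
Qed.

Lemma mdiff_split p q : exists u,
  p = (u + posm (mdiff p q))%MM /\ q = (u + negm (mdiff p q))%MM.
Proof.
(* The common factor is the gcd of the two monomials. *)
exists [multinom minn (p i) (q i) | i < n].
by split; apply/mnmP => i; rewrite mnmDE !mnmE mxE; case: ifP; lia.
Qed.

Lemma mdiffDl u p q : mdiff (u + p) (u + q) = mdiff p q.
Proof. by apply/rowP => i; rewrite !mxE !mnmDE; lia. Qed.

(** Dividing by the gcd leaves the lattice binomial of the exponent difference. *)
Lemma mem_lattice_ideal (L : zmodClosed 'rV[int]_n) p q :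
  mdiff p q \in L -> lattice_ideal K L ('X_[p] - 'X_[q]).
Proof.
have [u [pE qE]] := mdiff_split p q => pqL.
rewrite [in 'X_[p]]pE [in 'X_[q]]qE !mpolyXD -mulrBr; apply/ideal_genM/ideal_gen_mem.
by exists (mdiff p q); rewrite ?lattice_binomialE.
Qed.

End Monomials.

(** * Folding the new coordinate onto coordinate [i] *)

Section Fold.
Variables (K : fieldType) (n : nat) (i : 'I_n).
Implicit Types (p q : 'X_{1..n.+1}) (w : 'rV[int]_n.+1).

Definition fold_mx : 'M[int]_(n.+1, n) :=
  \matrix_(j, k) (odflt i (unlift ord_max j) == k)%:R.

Lemma fold_mxE w k :
  (w *m fold_mx) 0 k = w 0 (lift ord_max k) + w 0 ord_max *+ (k == i).
Proof.
rewrite mxE (bigD1_ord ord_max) //= addrC mxE unlift_none /= eq_sym.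
rewrite mulr_natr; congr (_ + _).
rewrite (bigD1 k) //= mxE liftK eqxx mulr1 big1 ?addr0 // => j /negPf jk.
by rewrite mxE liftK /= jk mulr0.
Qed.

Definition foldm p : 'X_{1..n} :=
  [multinom (p (lift ord_max k) + p ord_max * (k == i))%N | k < n].

Lemma identify_is_additive : zmod_morphism (@identify K n i).
Proof. by move=> p q; rewrite /identify raddfB. Qed.
Lemma identify_is_multiplicative : monoid_morphism (@identify K n i).
Proof. by split=> [|p q]; rewrite /identify ?rmorph1 ?rmorphM. Qed.
HB.instance Definition _ :=
  GRing.isZmodMorphism.Build _ _ (@identify K n i) identify_is_additive.
HB.instance Definition _ :=
  GRing.isMonoidMorphism.Build _ _ (@identify K n i) identify_is_multiplicative.

Lemma identifyX p : identify i 'X_[p] = 'X_[foldm p] :> {mpoly K[n]}.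
Proof.
rewrite /identify comp_mpolyX (bigD1_ord ord_max) //= tnth_mktuple unlift_none /=.
rewrite [RHS]mpolyXE_id.
under eq_bigr => k _ do rewrite tnth_mktuple liftK /=.
under [RHS]eq_bigr => k _ do rewrite mnmE exprD.
rewrite big_split /= mulrC; congr (_ * _).
rewrite (bigD1 i) //= eqxx muln1 big1 ?mulr1 // => k /negPf->.
by rewrite muln0 expr0.
Qed.

(** A preimage is the same polynomial, read as one without the new variable. *)
Lemma identify_surj (f : {mpoly K[n]}) : exists g, identify i g = f.
Proof.
elim/mpolyind: f => [|c m f _ _ [g <-]]; first by exists 0; rewrite raddf0.
pose m' : 'X_{1..n.+1} :=
  [multinom if unlift ord_max j is Some k then m k else 0%N | j < n.+1].
exists (c%:MP * 'X_[m'] + g); rewrite raddfD /= rmorphM /= identifyX; congr (_ + _).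
rewrite /identify comp_mpolyC mul_mpolyC; congr (_ *: 'X_[_]).
by apply/mnmP => k; rewrite !mnmE liftK unlift_none addn0.
Qed.

Lemma mdiff_foldm p q : mdiff (foldm p) (foldm q) = mdiff p q *m fold_mx.
Proof. by apply/rowP => k; rewrite fold_mxE !mxE !mnmE; case: eqP; lia. Qed.

End Fold.

(** * From a separation of the lattice *)

Lemma fin_choice (T : finType) (U : Type) (P : T -> U -> Prop) :
  (forall x, exists y, P x y) -> exists f : T -> U, forall x, P x (f x).
Proof. exact: fin_all_exists. Qed.

Lemma mdiffN n (p q : 'X_{1..n}) : mdiff q p = - mdiff p q.
Proof. by apply/rowP => k; rewrite !mxE opprB. Qed.

Definition extend0 n (v : 'rV[int]_n) : 'rV[int]_n.+1 :=
  \row_j (if unlift ord_max j is Some k then v 0 k else 0).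

Lemma extend0_lift n (v : 'rV[int]_n) k : extend0 v 0 (lift ord_max k) = v 0 k.
Proof. by rewrite mxE liftK. Qed.

Lemma extend0_max n (v : 'rV[int]_n) : extend0 v 0 ord_max = 0.
Proof. by rewrite mxE unlift_none. Qed.

Lemma row_lift_eq n (u w : 'rV[int]_n.+1) :
  (forall k, u 0 (lift ord_max k) = w 0 (lift ord_max k)) ->
  u 0 ord_max = w 0 ord_max -> u = w.
Proof. by move=> uw um; apply/rowP => j; case: (unliftP ord_max j) => [k|] ->. Qed.

Section SeparationLattice.
Variables (K : fieldType) (n : nat) (i : 'I_n).
Variables (L : zmodClosed 'rV[int]_n) (L' : zmodClosed 'rV[int]_n.+1).
Hypothesis idealL : forall p : {mpoly K[n]}, lattice_ideal K L p <->
  exists2 q, lattice_ideal K L' q & identify i q = p.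

(** These images under [identify i] generate I_L, so a chain of moves between monomials of one fiber
    of [L] can be taken to consist of moves that come from [L']. *)
Definition folded_binomial (f : {mpoly K[n]}) :=
  exists p q, mdiff p q \in L' /\ f = 'X_[foldm i p] - 'X_[foldm i q].

Lemma lattice_ideal_folded f : lattice_ideal K L f -> ideal_gen folded_binomial f.
Proof.
move=> /idealL[_ [s [sL' ->]] <-].
rewrite raddf_sum /=; exists [seq (identify i u.1, identify i u.2) | u <- s].
split; last by rewrite big_map; apply: eq_bigr => u _; rewrite rmorphM.
move=> _ /mapP[u /sL'[w wL' uE] ->] /=; exists (posm w), (negm w).
by rewrite mdiff_posm_negm uE lattice_binomialE raddfB /= !identifyX.
Qed.

Lemma mem_folded_ideal p q : mdiff p q \in L' ->
  lattice_ideal K L ('X_[foldm i p] - 'X_[foldm i q]).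
Proof.
move=> pq; apply/idealL; exists ('X_[p] - 'X_[q]); first exact: mem_lattice_ideal.
by rewrite raddfB /= !identifyX.
Qed.

(** The identified binomial of [w] lies in I_L, and every generator of I_L preserves congruence
    modulo [L], so its two monomials are congruent. *)
Lemma fold_mem w : w \in L' -> w *m fold_mx i \in L.
Proof.
move=> wL'; rewrite -(mdiff_posm_negm w) -mdiff_foldm.
have /mem_folded_ideal : mdiff (posm w) (negm w) \in L' by rewrite mdiff_posm_negm.
move: (foldm i _) (foldm i _) => q p.
move/binomial_class => /(_ (fun m => mdiff p m \in L)) /=; apply.
  move=> _ [v vL ->]; exists (posm v), (negm v); rewrite lattice_binomialE.
  split=> // u'.
  have -> : mdiff p (u' + negm v) = mdiff p (u' + posm v) + v.
    by rewrite -[X in _ + X]mdiff_posm_negm; apply/rowP => k; rewrite !mxE !mnmDE; lia.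
  by rewrite rpredDr.
suff -> : mdiff p p = 0 by apply: rpred0.
by apply/rowP => k; rewrite !mxE subrr.
Qed.

(** Going from [posm v] to [negm v] by folded binomials, every move changes the exponent by the fold
    of a vector of [L']; these vectors add up to a preimage of [v]. *)
Lemma fold_surj v : v \in L -> exists2 w, w \in L' & v = w *m fold_mx i.
Proof.
move=> vL; have /lattice_ideal_folded : lattice_ideal K L ('X_[posm v] - 'X_[negm v]).
  by apply: mem_lattice_ideal; rewrite mdiff_posm_negm.
move/binomial_class => /(_ (fun m =>
  exists2 w, w \in L' & mdiff (posm v) m = w *m fold_mx i)).
rewrite mdiff_posm_negm; apply; last first.
  by exists 0; rewrite ?rpred0 // mul0mx; apply/rowP => k; rewrite !mxE subrr.
have half u p q : mdiff p q \in L' ->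
    (exists2 w, w \in L' & mdiff (posm v) (u + foldm i p) = w *m fold_mx i) ->
    exists2 w, w \in L' & mdiff (posm v) (u + foldm i q) = w *m fold_mx i.
  move=> pq [w wL' uw]; exists (w + mdiff p q); first by rewrite rpredD.
  by rewrite mulmxDl -uw -mdiff_foldm; apply/rowP => k; rewrite !mxE !mnmDE; lia.
move=> f [p [q [pq ->]]]; exists (foldm i p), (foldm i q); split=> // u.
by split; apply: half; rewrite // mdiffN rpredN.
Qed.

Section Rank.
Variables (r : nat) (B : 'M[int]_(r, n)) (B' : 'M[int]_(r, n.+1)).
Hypotheses (basisB : lattice_basis L B) (basisB' : lattice_basis L' B').

(* The two change-of-basis matrices are square, hence inverse to each other. *)
Lemma fold_inj w : w \in L' -> w *m fold_mx i = 0 -> w = 0.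
Proof.
have [indB genB] := basisB; have [_ genB'] := basisB'.
have row_mem s p (M : 'M[int]_(s, p)) k : exists c, row k M = c *m M.
  by exists (delta_mx 0 k); rewrite rowE.
have [C CE] : exists C : 'I_r -> 'rV[int]_r,
    forall k, row k B' *m fold_mx i = C k *m B.
  apply: (fin_choice (P := fun k c => row k B' *m fold_mx i = c *m B)) => k.
  have /fold_mem/genB // : row k B' \in L' by apply/genB'/row_mem.
have [D DE] : exists D : 'I_r -> 'rV[int]_r,
    forall k, row k B = D k *m B' *m fold_mx i.
  apply: (fin_choice (P := fun k c => row k B = c *m B' *m fold_mx i)) => k.
  have /fold_surj[u] : row k B \in L.
    by apply/genB/row_mem.
  by move=> /genB'[c ->] ->; exists c.
pose MC := \matrix_k C k; pose MD := \matrix_k D k.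
have CB : B' *m fold_mx i = MC *m B.
  by apply/row_matrixP => k; rewrite !row_mul CE rowK.
have DB : B = MD *m (B' *m fold_mx i).
  by apply/row_matrixP => k; rewrite !row_mul DE rowK mulmxA.
have MDC : MD *m MC = 1%:M.
  apply/eqP; rewrite -subr_eq0; apply/eqP/row_matrixP => k; rewrite row0.
  apply: indB; rewrite -row_mul mulmxBl mul1mx -mulmxA -CB -DB subrr.
  by rewrite row0.
move=> /genB'[c ->]; rewrite -mulmxA CB mulmxA => /indB cMC.
by rewrite -[c]mulmx1 -(mulmx1C MDC) mulmxA cMC !mul0mx.
Qed.

End Rank.

(* Every monomial of the fiber of [posm v] avoids the variables of positive
   weight, so only relations with zero entries at both copies of [i] occur. *)
Lemma fold_weight (d : 'I_n -> nat) v :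
  (0 < d i)%N -> (forall u, u \in L -> \sum_k u 0 k * (d k)%:Z = 0) ->
  v \in L -> (forall k, (0 < d k)%N -> v 0 k = 0) -> extend0 v \in L'.
Proof.
move=> di dL vL vd.
pose wt (u : 'X_{1..n}) := (\sum_k u k * d k)%N.
have wtE u u' : mdiff u u' \in L -> wt u = wt u'.
  move=> /dL; under eq_bigr => k _ do rewrite mxE mulrBl -!PoszM.
  rewrite sumrB -!(big_morph _ PoszD (erefl (Posz 0))) => /eqP.
  by rewrite subr_eq0 => /eqP[].
have : lattice_ideal K L ('X_[posm v] - 'X_[negm v]).
  by apply: mem_lattice_ideal; rewrite mdiff_posm_negm.
move/lattice_ideal_folded/binomial_class => /(_ (fun m =>
  extend0 (mdiff (posm v) m) \in L' /\ wt m = 0%N)).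
rewrite mdiff_posm_negm; case=> //; last first.
  split.
    rewrite (_ : extend0 _ = 0) ?rpred0 //.
    by apply/rowP => j; rewrite !mxE; case: unliftP => // k _; rewrite mxE subrr.
  rewrite /wt big1 // => k _; rewrite mnmE; case: (posnP (d k)) => [->|/vd->].
    by rewrite muln0.
  by rewrite lexx.
have half u p q : mdiff p q \in L' ->
    extend0 (mdiff (posm v) (u + foldm i p)) \in L' /\ wt (u + foldm i p)%MM = 0%N ->
    extend0 (mdiff (posm v) (u + foldm i q)) \in L' /\ wt (u + foldm i q)%MM = 0%N.
  move=> pq [uL' wt0].
  have wtq : wt (u + foldm i q)%MM = 0%N.
    rewrite -wt0; apply: wtE.
    by rewrite mdiffDl mdiff_foldm mdiffN mulNmx rpredN fold_mem.
  have wt_i m : wt (u + foldm i m)%MM = 0%N ->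
      m (lift ord_max i) = 0%N /\ m ord_max = 0%N.
    by rewrite /wt (bigD1 i) //= mnmDE mnmE eqxx; lia.
  split=> //; have [pi pm] := wt_i _ wt0; have [qi qm] := wt_i _ wtq.
  (* Neither [p] nor [q] involves the new variable, so [mdiff p q] is the zero extension of its own
     fold. *)
  have -> : extend0 (mdiff (posm v) (u + foldm i q)) =
      extend0 (mdiff (posm v) (u + foldm i p)) + mdiff p q.
    apply: row_lift_eq => [k|]; rewrite !mxE ?liftK ?unlift_none ?pm ?qm //.
    by rewrite !mxE !mnmDE !mnmE pm qm; lia.
  by rewrite rpredD.
move=> f [p [q [pq ->]]]; exists (foldm i p), (foldm i q); split=> // u.
by split; apply: half; rewrite // mdiffN rpredN.
Qed.

End SeparationLattice.

(** * Circulations *)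

Section Boundary.
Variables (m n : nat) (e : 'I_n -> {set 'I_m}) (sgn : 'I_m -> int).
Hypothesis edge_ends : forall k, exists x y, e k = [set x; y].
Hypothesis edge_sgn : forall k x y, e k = [set x; y] -> x != y /\ sgn y = - sgn x.
Hypothesis sgn_unit : forall x, sgn x = 1 \/ sgn x = -1.

Implicit Types (x y z : 'I_m) (k : 'I_n) (v : 'rV[int]_n).

Definition vertex x : 'rV[int]_m := delta_mx 0 x.

(* The edge vectors with the entries at the vertices of sign -1 negated, so
   that a path becomes a chain whose boundary is supported at its ends. *)
Definition boundary_mx : 'M[int]_(n, m) := \matrix_(k, x) (sgn x *+ (x \in e k)).

Local Notation D := boundary_mx.
Local Notation L := (relation_lattice (edge_vectors e)).

Lemma sgn2 x : sgn x * sgn x = 1.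
Proof. by case: (sgn_unit x) => ->. Qed.

(** The two matrices differ by scaling each column with a sign, which does not change the kernel. *)
Lemma mem_relation_lattice v : (v \in L) = (v *m D == 0).
Proof.
have vDE x : (v *m D) 0 x = sgn x * (v *m edge_vectors e) 0 x.
  rewrite !mxE mulr_sumr; apply: eq_bigr => k _; rewrite !mxE summxE.
  under eq_bigr => y _ do rewrite mxE eqxx /= eq_sym.
  rewrite mulrCA; congr (_ * _); rewrite -mulr_natr; congr (_ * _).
  have [xk|xk] := boolP (x \in e k).
    by rewrite (bigD1 x) //= eqxx big1 ?addr0 // => y /andP[_ /negPf->].
  rewrite big1 // => y yk; case: eqP => // yx; by rewrite -yx yk in xk.
rewrite inE; apply/eqP/eqP => [v0|v0].
  by apply/rowP => x; rewrite vDE v0 !mxE mulr0.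
apply/rowP => x; rewrite -[LHS]mul1r -(sgn2 x) -mulrA -vDE v0 !mxE mulr0 //.
Qed.

Lemma boundary_edge k x y : e k = [set x; y] ->
  delta_mx 0 k *m D = sgn x *: (vertex x - vertex y).
Proof.
move=> ek; have [xy yx] := edge_sgn ek.
apply/rowP => z; rewrite -rowE !mxE ek !inE !eqxx /=.
case: (eqVneq z x) => [->|zx]; first by rewrite (negPf xy) /=; lia.
by case: (eqVneq z y) => [->|zy] /=; lia.
Qed.

Lemma other_end k x : x \in e k -> exists2 y, e k = [set x; y] & y != x.
Proof.
have [y [z ek]] := edge_ends k; have [yz _] := edge_sgn ek.
rewrite ek !inE => /orP[]/eqP->; first by exists z; rewrite // eq_sym.
by exists y; rewrite // setUC.
Qed.

(** A step from [x] to [y] contributes its edge with coefficient [sgn x], whose boundary is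
    [vertex x - vertex y]; along the path these telescope. *)
Lemma path_chain (r : rel 'I_m) x y :
  (forall u w, r u w -> exists k, e k = [set u; w]) -> connect r x y ->
  exists2 P : 'rV[int]_n, P *m D = vertex x - vertex y &
    forall k, P 0 k != 0 -> exists u w, r u w /\ e k = [set u; w].
Proof.
move=> rE /connectP[p rp ->{y}]; elim: p x rp => [|y p IHp] x /=.
  by exists 0; rewrite ?mul0mx ?subrr // => k; rewrite mxE eqxx.
case/andP=> rxy /IHp[P PD Pr]; have [k ek] := rE _ _ rxy.
exists (sgn x *: delta_mx 0 k + P) => [|j].
  rewrite mulmxDl PD -scalemxAl (boundary_edge ek) scalerA sgn2 scale1r.
  by rewrite addrA subrK.
rewrite !mxE eqxx /=; case: (eqVneq j k) => [->|jk]; first by exists x, y.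
by rewrite mulr0 add0r => /Pr.
Qed.

Lemma sum_boundary (S : {set 'I_m}) v :
  \sum_(x in S) (v *m D) 0 x = \sum_k v 0 k * \sum_(x in S) (sgn x *+ (x \in e k)).
Proof.
under eq_bigr => x _ do rewrite mxE.
rewrite exchange_big; apply: eq_bigr => k _; rewrite mulr_sumr.
by apply: eq_bigr => x _; rewrite mxE.
Qed.

(** With [sum_boundary] this is the cut argument: as the ends of an edge have opposite signs, only
    edges with exactly one end in [S] contribute. *)
Lemma sum_sgn (S : {set 'I_m}) k x y : e k = [set x; y] ->
  \sum_(z in S) (sgn z *+ (z \in e k)) = sgn x * ((x \in S)%:R - (y \in S)%:R).
Proof.
move=> ek; have [xy yx] := edge_sgn ek.
under eq_bigr => z _ do rewrite mulrb.
rewrite -big_mkcondr /= (eq_bigl (fun z => (z \in [set x; y]) && (z \in S))).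
  rewrite big_mkcondr /= big_setU1 ?inE //= big_set1 yx.
  by case: (x \in S); case: (y \in S); lia.
by move=> z; rewrite ek andbC.
Qed.

(** * Directed cycles inside a circulation *)

Section ConformalCycle.
Variable v : 'rV[int]_n.
Hypotheses (vL : v \in L) (v0 : v != 0).

(** Orient every edge [k] in the support of [v] away from its end [x] with [0 < sgn x * v 0 k]; then
    [out x] says that some edge leaves [x]. *)
Let out x := [exists k, (x \in e k) && (0 < sgn x * v 0 k)].

(** Conservation at [y]: if no edge left [y], all terms of its boundary sum would be nonpositive and
    that of [k] negative. *)
Lemma out_next x k y : e k = [set x; y] -> 0 < sgn x * v 0 k -> out y.
Proof.
move=> ek xk; have [xy yx] := edge_sgn ek; apply/existsPn => /= nout.
have /eqP : (v *m D) 0 y = 0.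
  by move: vL; rewrite mem_relation_lattice => /eqP->; rewrite mxE.
rewrite mxE (bigD1 k) //= mxE ek !inE eqxx orbT mulr1n yx mulrN mulrC.
move: xk; set s := sgn x * _ => xk /eqP.
have : \sum_(i < n | i != k) v 0 i * D i y <= 0.
  apply: sumr_le0 => j _; rewrite mxE.
  by have := nout j; case: (y \in e j) => /=; lia.
set t := \sum_(i < n | _) _; lia.
Qed.

(* A minimal nonempty set of vertices stable under a choice of successor along
   [v] is a union of directed cycles. *)
Lemma conformal_cycle : exists c : 'rV[int]_n, [/\ c \in L, c != 0 &
  forall k, [\/ c 0 k = 0, c 0 k = 1 /\ 0 < v 0 k | c 0 k = -1 /\ v 0 k < 0]].
Proof.
have [f fP] : exists f : 'I_m -> 'I_n * 'I_m, forall x, out x ->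
    [/\ e (f x).1 = [set x; (f x).2], 0 < sgn x * v 0 (f x).1 & out (f x).2].
  apply: (fin_choice (P := fun x ky => out x ->
    [/\ e ky.1 = [set x; ky.2], 0 < sgn x * v 0 ky.1 & out ky.2])) => x.
  have [/existsP[k /andP[xk kpos]]|nx] := boolP (out x).
    have [y ek _] := other_end xk; exists (k, y) => _; split=> //=.
    exact: out_next ek kpos.
  (* Where no edge leaves [x] the value is arbitrary; [v != 0] only supplies some edge index. *)
  have /rV0Pn[k _] := v0; exists (k, x) => ox; by case: (negP nx).
pose stable O := [&& O != set0, O \subset [set x | out x] &
                     [set (f x).2 | x in O] \subset O].
have : stable [set x | out x].
  apply/and3P; split=> //; last first.
    by apply/subsetP => _ /imsetP[x + ->]; rewrite !inE => /fP[].
  have /rV0Pn[k vk] := v0; have [x [y ek]] := edge_ends k.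
  have [xy yx] := edge_sgn ek; apply/set0Pn.
  have [vpos|vneg] : 0 < sgn x * v 0 k \/ 0 < sgn y * v 0 k.
    rewrite yx mulNr oppr_gt0; apply/orP; rewrite orbC -neq_lt mulf_neq0 //.
    by case: (sgn_unit x) => ->.
  - by exists x; rewrite inE; apply/existsP; exists k; rewrite ek !inE eqxx.
  - by exists y; rewrite inE; apply/existsP; exists k; rewrite ek !inE eqxx orbT.
case/minset_exists => O /minsetP[/and3P[O0 Oout fO] Omin] _.
(* The image of [O] is again stable, so by minimality the successor map permutes [O]. *)
have fOO : [set (f x).2 | x in O] = O.
  apply: Omin => //; apply/and3P; split.
  - by case/set0Pn: O0 => x xO; apply/set0Pn; exists (f x).2; apply: imset_f.
  - exact: subset_trans Oout.
  - by apply: imsetS.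
have finj : {in O &, injective (fun x => (f x).2)}.
  by apply/imset_injP; rewrite fOO.
have outO x : x \in O -> out x by move/(subsetP Oout); rewrite inE.
pose c : 'rV[int]_n := \sum_(x in O) sgn x *: delta_mx 0 (f x).1.
have cE k : c 0 k = \sum_(x in O | (f x).1 == k) sgn x.
  rewrite summxE big_mkcondr /=; apply: eq_bigr => x _.
  by rewrite !mxE eqxx /= eq_sym; case: eqP; rewrite ?mulr1 ?mulr0.
(* Distinct vertices of [O] use distinct edges: a shared edge would leave both of its ends, where
   the signs are opposite. *)
have cf x : x \in O -> c 0 (f x).1 = sgn x.
  move=> xO; rewrite cE (bigD1 x) ?xO ?eqxx //= big1 ?addr0 // => y.
  case/andP=> /andP[yO /eqP yx] nyx.
  have [ey ypos _] := fP _ (outO _ yO); have [ex xpos _] := fP _ (outO _ xO).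
  have [_ sx] := edge_sgn ex.
  have : y \in e (f x).1 by rewrite -yx ey !inE eqxx.
  rewrite ex !inE (negPf nyx) /= => /eqP yE.
  by move: ypos xpos; rewrite yx yE sx; lia.
exists c; split.
- rewrite mem_relation_lattice; apply/eqP; rewrite mulmx_suml.
  have -> : \sum_(x in O) (sgn x *: delta_mx 0 (f x).1) *m D =
      \sum_(x in O) (vertex x - vertex (f x).2).
    apply: eq_bigr => x xO; have [ex _ _] := fP _ (outO _ xO).
    by rewrite -scalemxAl (boundary_edge ex) scalerA sgn2 scale1r.
  by rewrite sumrB -(big_imset _ finj) fOO subrr.
- case/set0Pn: O0 => x xO; apply/rV0Pn; exists (f x).1; rewrite cf //.
  by case: (sgn_unit x) => ->.
- move=> k; have [/existsP[x /andP[xO /eqP <-]]|] :=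
    boolP [exists x, (x \in O) && ((f x).1 == k)].
    rewrite cf //; have [_ + _] := fP _ (outO _ xO).
    case: (sgn_unit x) => ->; rewrite ?mul1r ?mulN1r => ?.
      by apply: Or32.
    by apply: Or33; split=> //; lia.
  move/existsPn => nk; apply: Or31; rewrite cE big1 // => x /andP[xO xk].
  by have := nk x; rewrite xO xk.
Qed.

End ConformalCycle.

End Boundary.

(** * Cycles and components *)

Section Internal.
Variable T : finType.
Implicit Types (H : sgraph T) (S : {set T}) (x y : T) (r : rel T).

Lemma adj_sym H : ssrbool.symmetric (adj H).
Proof. by move=> x y; rewrite /adj setUC. Qed.

Lemma adj_neq H x y : adj H x y -> x != y.
Proof. by move/esetP/andP=> [_]; rewrite cards2; case: (x != y). Qed.

(** A path from [x] only visits vertices reachable from [x]; this keeps a path inside an induced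
    subgraph containing its component. *)
Lemma connect_within r x y :
  connect r x y -> connect (fun u w => [&& r u w, connect r x u & connect r x w]) x y.
Proof.
set r' := fun u w => _; move=> /connectP[p rp ->{y}].
suff within z : path r z p -> connect r x z -> connect r' z (last z p).
  exact: within.
elim: p z {rp} => //= y p IHp z /andP[rzy rp] xz.
have xy := connect_trans xz (connect1 rzy).
by apply: connect_trans (IHp _ rp xy); apply: connect1; rewrite /r' rzy xz.
Qed.

Lemma internal_connect H x y : adj H x y ->
  connect (fun u w => adj H u w && ([set u; w] != [set x; y])) y x ->
  internal H [set x; y].
Proof.
move=> Hxy /connectP[p]; case/shortenP=> q rq uq _ {p} xE.
have sub : subrel (fun u w => adj H u w && ([set u; w] != [set x; y])) (adj H).
  by move=> u w /andP[].
case/lastP: q => [|q z] in rq uq xE *.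
  by move: (adj_neq Hxy); rewrite xE eqxx.
rewrite last_rcons in xE; rewrite -{z}xE in rq uq.
exists (x :: y :: q); split.
(* A path of length one from [y] to [x] would be the excluded edge itself, so the cycle has at least
   three vertices. *)
- case: q rq uq => [|//] /=; rewrite andbT => /andP[_].
  by rewrite setUC eqxx.
- rewrite /ucycle; apply/andP; split; last by rewrite -rcons_cons rcons_uniq in uq.
  by rewrite /= Hxy; apply: sub_path rq.
- by exists x; rewrite ?mem_head //= eqxx.
Qed.

(** Rotate the cycle so that it starts with [f]; the remainder is a path back that avoids [f],
    because the vertices of the cycle are distinct. *)
Lemma connect_internal H f : internal H f -> exists x y,
  f = [set x; y] /\ connect (fun u w => adj H u w && ([set u; w] != f)) y x.
Proof.
case=> c [c2 /andP[cH cU] [x xc fE]].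
case: (rot_to xc) => j [|y [|z s]] cE.
- by move: c2; rewrite -(size_rot j) cE.
- by move: c2; rewrite -(size_rot j) cE.
have yE : next c x = y by rewrite -(next_rot j cU) cE /= eqxx.
move: cH cU; rewrite -(rot_cycle j) -(rot_uniq j) cE => cH cU.
rewrite yE in fE; exists x, y; split=> //.
move: cH cU => /= /and3P[_ yz zs] /and3P[/norP[xy /norP[xz xs]] /norP[yz' ys] _].
have f_neq u w : u != x -> u != y -> [set u; w] != f.
  move=> ux uy; rewrite fE; apply/eqP => /setP/(_ u).
  by rewrite !inE eqxx (negPf ux) (negPf uy).
apply: connect_trans (_ : connect _ z x).
  apply: connect1; rewrite yz setUC f_neq // eq_sym //.
have: (z != x) && (z != y) by rewrite !(eq_sym z) xz yz'.
elim: s z zs xs ys {yz xz yz' cE} => [|w s IHs] z /=.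
  by rewrite andbT => zx _ _ /andP[? ?]; apply: connect1; rewrite zx f_neq.
case/andP=> zw ws /norP[xw xs] /norP[yw ys] /andP[? ?].
apply: connect_trans (IHs w ws xs ys _); last by rewrite !(eq_sym w) xw yw.
by apply: connect1; rewrite zw f_neq.
Qed.

Fact inducedP (G : sgraph T) S f :
  f \in [set f in eset G | f \subset S] -> (f \subset S :&: vset G) && (#|f| == 2).
Proof. by rewrite inE subsetI => /andP[/esetP/andP[-> ->] ->]. Qed.

Definition induced G S := SGraph (@inducedP G S).

Lemma induced_adj G S x y :
  adj (induced G S) x y = [&& adj G x y, x \in S & y \in S].
Proof. by rewrite /adj inE subUset !sub1set. Qed.

(** * Components after deleting the ends of an edge *)

Section Components.
Variables (G : sgraph T) (a b : T).
Hypothesis ab : adj G a b.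

Definition off_edge x := (x != a) && (x != b).
(** Adjacency in G - {a, b}, kept as a relation on the whole type, in which [a] and [b] are
    isolated. *)
Definition off_adj : rel T := fun x y => [&& adj G x y, off_edge x & off_edge y].

Lemma off_adj_sym : connect_sym off_adj.
Proof.
by apply: sym_connect_sym => x y; rewrite /off_adj adj_sym [off_edge y && _]andbC.
Qed.

Lemma connect_off x y : off_edge x -> connect off_adj x y -> off_edge y.
Proof.
move=> xo /connectP[p pp ->]; elim: p x xo pp => //= z p IHp x _.
by case/andP=> /and3P[_ _ zo] /(IHp _ zo).
Qed.

(** A component of G - {a, b} adjacent to both [a] and [b], represented by a neighbour [x] of [a] in
    it. *)
Definition meets_both x := exists y,
  [/\ adj G a x, adj G b y, off_edge x, off_edge y & connect off_adj x y].

(** The cycle goes from [a] to [x], through the component to [y], then to [b], and closes along the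
    edge. *)
Lemma internal_induced S x : a \in S -> b \in S ->
  (forall u, connect off_adj x u -> u \in S) -> meets_both x ->
  internal (induced G S) [set a; b].
Proof.
move=> aS bS xS [y [ax by_ xo yo xy]].
have axS : x \in S by apply/xS/connect0.
have byS : y \in S by apply: xS.
have f_neq u w : off_edge u -> [set u; w] != [set a; b].
  case/andP=> ua ub; apply/eqP => /setP/(_ u).
  by rewrite !inE eqxx (negPf ua) (negPf ub).
apply: internal_connect; first by rewrite induced_adj ab aS.
apply: connect_trans (_ : connect _ y a).
  by apply: connect1; rewrite induced_adj by_ bS byS setUC f_neq.
have sym : connect_sym (fun u w => adj (induced G S) u w && ([set u; w] != [set a; b])).
  by apply: sym_connect_sym => u w; rewrite adj_sym setUC.
rewrite sym; apply: connect_trans (_ : connect _ x y).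
  by apply: connect1; rewrite induced_adj ax aS axS setUC f_neq.
apply: connect_sub (connect_within xy) => u w /and3P[/and3P[uw uo wo] xu xw].
by apply: connect1; rewrite induced_adj uw !xS // f_neq.
Qed.

(** One side is the component of [x] together with [a] and [b], the other is everything outside that
    component; [x'] supplies the cycle of the second side. *)
Lemma separable_components x x' :
  vset G = setT -> meets_both x -> meets_both x' -> ~~ connect off_adj x x' ->
  separable_by G [set a; b].
Proof.
move=> GT mx mx' nxx'; pose C := [set u | connect off_adj x u].
have nxa : ~~ connect off_adj x a.
  apply/negP; case: mx => y [_ _ xo _ _] /(connect_off xo).
  by rewrite /off_edge eqxx.
have nxb : ~~ connect off_adj x b.
  apply/negP; case: mx => y [_ _ xo _ _] /(connect_off xo).
  by rewrite /off_edge eqxx andbF.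
have aC : a \notin C by rewrite inE.
have bC : b \notin C by rewrite inE.
have neqab := adj_neq ab.
exists (induced G (C :|: [set a; b])), (induced G (~: C)); split.
- split.
  + by split; rewrite /= ?subsetIr //; apply/subsetP => f; rewrite inE => /andP[].
  + by split; rewrite /= ?subsetIr //; apply/subsetP => f; rewrite inE => /andP[].
  + by apply/set0Pn; exists a; rewrite /= GT !inE eqxx orbT.
  + by apply/set0Pn; exists a; rewrite /= GT inE inE aC inE.
- split.
    apply/setP => f; rewrite !inE; apply/idP/eqP => [|->]; last first.
      by rewrite -/(adj G a b) ab !subUset !sub1set !inE !eqxx ?orbT nxa nxb.
    case/andP=> /andP[fG fab] /andP[_ fC].
    have /andP[_ /eqP f2] := esetP fG.
    apply/eqP; rewrite eqEcard f2 cards2 neqab /= andbT.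
    apply/subsetP => u uf; have := subsetP fab u uf; have := subsetP fC u uf.
    by rewrite !inE => /negPf->.
  rewrite /= GT !setIT; apply/setP => u; rewrite !inE.
  have [->|ua] := eqVneq u a; first by rewrite orbT nxa.
  have [->|ub] := eqVneq u b; first by rewrite !orbT nxb.
  by rewrite !orbF andbN.
- split; last first.
    rewrite /= GT !setIT; apply/setP => u; rewrite !inE.
    by case: (connect off_adj x u); rewrite ?orbT.
  apply/setP => f; rewrite !inE -andb_orr.
  have [fG|//] := boolP (f \in eset G); rewrite /=; apply/esym.
  have [//|] := boolP (f \subset ~: C); rewrite ?orbT //.
  case/subsetPn => u uf; rewrite !inE negbK orbF => xu.
  apply/subsetP => w wf; rewrite !inE.
  have [->|wu] := eqVneq w u; first by rewrite xu.
  have [_|wa] := eqVneq w a; first by rewrite orbT.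
  have [_|wb] := eqVneq w b; first by rewrite !orbT.
  have uo : off_edge u by case: mx => y [_ _ xo _ _]; apply: connect_off xu.
  rewrite !orbF; apply: connect_trans xu _; apply: connect1.
  rewrite /off_adj /adj uo /off_edge wa wb !andbT.
  suff <- : f = [set u; w] by [].
  apply/esym/eqP; have /andP[_ /eqP f2] := esetP fG.
  by rewrite eqEcard f2 cards2 eq_sym wu subUset !sub1set uf wf.
- split.
    apply: internal_induced mx; rewrite ?inE ?eqxx ?orbT // => u xu.
    by rewrite !inE xu.
  apply: internal_induced mx'; rewrite ?[_ \in ~: _]inE // => u xu.
  rewrite !inE; apply: contra nxx' => xu'; apply: connect_trans xu' _.
  by rewrite off_adj_sym.
Qed.

End Components.
End Internal.

(** * Separations of the lattice separate the graph *)

(** Bipartiteness enters the proof only here, through a sign that changes along every edge. *)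
Lemma bipartite_sgn m n (G : sgraph 'I_m) (e : 'I_n -> {set 'I_m}) :
  edge_enumeration G e -> bipartite G -> exists sgn : 'I_m -> int,
  [/\ forall k, exists x y, e k = [set x; y],
      forall k x y, e k = [set x; y] -> x != y /\ sgn y = - sgn x &
      forall x, sgn x = 1 \/ sgn x = -1].
Proof.
case=> _ _ GE [A [B [_ AB EAB]]].
have eAB k : exists x y, [/\ x \in A, y \in B & e k = [set x; y]].
  by apply: EAB; rewrite GE imset_f.
exists (fun x => if x \in A then 1 else -1); split=> [k|k x y ek|x]; last first.
- by case: ifP; [left|right].
- have [x' [y' [xA yB ek']]] := eAB k.
  have yA : y' \notin A by rewrite (disjointFl AB).
  have xy' : x' != y' by apply: contraNneq yA => <-.
  have xy : x != y by have := cards2 x y; rewrite -ek ek' cards2 xy'; case: (x != y).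
  have := set21 x y; have := set22 x y; rewrite -ek ek' !inE => yE xE.
  split=> //; case/orP: xE => /eqP xE; case/orP: yE => /eqP yE; subst.
  + by rewrite eqxx in xy.
  + by rewrite xA (negPf yA).
  + by rewrite xA (negPf yA) opprK.
  + by rewrite eqxx in xy.
- by have [x [y [_ _ ->]]] := eAB k; exists x, y.
Qed.

Section EdgeSeparation.
Variables (m n : nat) (G : sgraph 'I_m) (e : 'I_n -> {set 'I_m}).
Hypothesis eG : edge_enumeration G e.
Variable sgn : 'I_m -> int.
Hypothesis edge_ends : forall k, exists x y, e k = [set x; y].
Hypothesis edge_sgn : forall k x y, e k = [set x; y] -> x != y /\ sgn y = - sgn x.
Hypothesis sgn_unit : forall x, sgn x = 1 \/ sgn x = -1.

Local Notation D := (boundary_mx e sgn).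
Local Notation L := (relation_lattice (edge_vectors e)).

Lemma mem_edge_set f : f \in eset G -> exists k, e k = f.
Proof. by case: eG => _ _ -> /imsetP[k _ ->]; exists k. Qed.

Lemma edge_mem_eset k : e k \in eset G.
Proof. by case: eG => _ _ ->; apply: imset_f. Qed.

Lemma boundary0 v x : v \in L -> \sum_k v 0 k * (sgn x *+ (x \in e k)) = 0.
Proof.
rewrite (mem_relation_lattice e sgn_unit) => /eqP/rowP/(_ x).
by rewrite !mxE => {2}<-; apply: eq_bigr => k _; rewrite mxE.
Qed.

Lemma incidence0 v x : v \in L -> \sum_k v 0 k * (x \in e k)%:Z = 0.
Proof.
move=> /(boundary0 x) /(congr1 (fun t => sgn x * t)); rewrite mulr0 mulr_sumr => E.
rewrite -{}[RHS]E; apply: eq_bigr => k _; rewrite mulrCA mulrnAr (sgn2 sgn_unit).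
by case: (x \in e k).
Qed.

Section SplitOff.
Variables (i : 'I_n) (a b : 'I_m).
Hypothesis ei : e i = [set a; b].
Hypothesis one_component : forall x x',
  meets_both G a b x -> meets_both G a b x' -> connect (off_adj G a b) x x'.
Variable v : 'rV[int]_n.
Hypotheses (vL : v \in L) (vi : v 0 i = 0).

Local Notation r := (off_adj G a b).
Local Notation off := (off_edge a b).
Let at_a k := (a \in e k) && (k != i).

(** Injectivity of [e] rules out a second edge joining [a] and [b]. *)
Lemma at_a_end : exists o : 'I_n -> 'I_m,
  forall k, at_a k -> e k = [set a; o k] /\ off (o k).
Proof.
apply: (fin_choice (P := fun k x => at_a k -> e k = [set a; x] /\ off x)) => k.
have [/andP[ak ki]|_] := boolP (at_a k); last by exists a.
have [x ek xa] := other_end edge_ends edge_sgn ak.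
exists x => _; split=> //; rewrite /off_edge xa.
apply: contraNneq ki => xb; have [_ inj_e _] := eG.
by apply/eqP/inj_e; rewrite ek xb.
Qed.

Variable o : 'I_n -> 'I_m.
Hypothesis oP : forall k, at_a k -> e k = [set a; o k] /\ off (o k).

Let S z := \sum_(k | at_a k && (fingraph.root r (o k) == z)) v 0 k.

(** Sum the zero boundary of [v] over the component with root [z]. Inner edges cancel and no edge
    comes from [b], so only the edges from [a] remain. *)
Lemma component_sum_no_b z :
  (forall y, off y -> adj G b y -> fingraph.root r y != z) -> S z = 0.
Proof.
move=> nb; pose C := [set x | off x && (fingraph.root r x == z)].
have vD0 x : (v *m D) 0 x = 0.
  by move: vL; rewrite (mem_relation_lattice e sgn_unit) => /eqP->; rewrite mxE.
have := sum_boundary e sgn C v; rewrite big1 => [/esym E|x _]; last exact: vD0.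
have aC : a \notin C by rewrite inE /off_edge eqxx.
have bC : b \notin C by rewrite inE /off_edge eqxx andbF.
suff E' : \sum_k v 0 k * \sum_(x in C) (sgn x *+ (x \in e k)) = - sgn a * S z.
  by move: E; rewrite E' => /eqP; rewrite mulf_eq0; case: (sgn_unit a) => -> /eqP.
rewrite /S mulr_sumr [RHS]big_mkcond; apply: eq_bigr => k _.
have [ak|/negP nak] := boolP (at_a k).
  have [ek ok] := oP ak; rewrite (sum_sgn edge_sgn C ek) (negPf aC) inE ok /=.
  by case: (fingraph.root _ _ == z) => /=; ring.
rewrite /=; apply/eqP; rewrite mulf_eq0; apply/orP.
have [ki|ki] := eqVneq k i; first by left; rewrite ki vi.
right; have nka : a \notin e k by apply/negP => ka; case: nak; rewrite /at_a ka.
have [kb|kb] := boolP (b \in e k).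
  have [y ek yb] := other_end edge_ends edge_sgn kb.
  have yo : off y.
    by rewrite /off_edge yb andbT; apply: contraNneq nka => <-; rewrite ek !inE eqxx orbT.
  rewrite (sum_sgn edge_sgn C ek) (negPf bC) inE yo (negPf (nb y _ _)) ?subrr ?mulr0 //.
  by rewrite /adj -ek edge_mem_eset.
have [x [y ek]] := edge_ends k.
move: nka kb; rewrite ek !inE => /norP[xa ya] /norP[xb yb].
have rxy : r x y.
  rewrite /off_adj /adj -ek edge_mem_eset /off_edge.
  by rewrite !(eq_sym _ a) !(eq_sym _ b) xa ya xb yb.
have xo : off x by case/and3P: rxy.
have yo : off y by case/and3P: rxy.
rewrite -ek (sum_sgn edge_sgn C ek) !inE xo yo /=.
have /eqP -> : fingraph.root r x == fingraph.root r y.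
  by rewrite root_connect ?connect1 //; apply: off_adj_sym.
by rewrite subrr mulr0.
Qed.

Lemma sum_at_a : \sum_(k | at_a k) v 0 k = 0.
Proof.
rewrite -[RHS](incidence0 a vL) [RHS](bigD1 i) //= vi mul0r add0r.
rewrite big_mkcond [RHS]big_mkcond /=; apply: eq_bigr => k _.
rewrite /at_a; case: (k != i); rewrite ?andbF //=.
by case: (a \in e k); rewrite ?mulr1 ?mulr0.
Qed.

(** Only one component can meet both [a] and [b]. The sums of all the others vanish, and the total
    over the edges at [a] vanishes too, hence so does the remaining sum. *)
Lemma component_sum z : S z = 0.
Proof.
have sym := off_adj_sym G a b.
have [/existsP[y /and3P[yo by_ /eqP yz]]|nb] :=
  boolP [exists y, [&& off y, adj G b y & fingraph.root r y == z]]; last first.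
  apply: component_sum_no_b => y yo by_; apply: contraNN nb => yz.
  by apply/existsP; exists y; rewrite yo by_ yz.
have [/existsP[k /andP[ak /eqP kz]]|na] :=
  boolP [exists k, at_a k && (fingraph.root r (o k) == z)]; last first.
  by rewrite /S big_pred0 // => k; apply/negP => kz; case/existsP: na; exists k.
have meets k' y' : at_a k' -> off y' -> adj G b y' ->
    fingraph.root r (o k') = fingraph.root r y' ->
    meets_both G a b (o k').
  move=> ak' yo' by' /eqP; rewrite root_connect // => ky.
  have [ek ok] := oP ak'; exists y'; split=> //.
  by rewrite /adj -ek edge_mem_eset.
have mk : meets_both G a b (o k) by apply: (meets k y); rewrite // kz yz.
have Sz' z' : z' != z -> S z' = 0.
  move=> zz'; have [/existsP[k' /andP[ak' /eqP kz']]|na] :=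
    boolP [exists k, at_a k && (fingraph.root r (o k) == z')]; last first.
    by rewrite /S big_pred0 // => k'; apply/negP => kz'; case/existsP: na; exists k'.
  apply: component_sum_no_b => y' yo' by'; apply: contraNneq zz' => yz'.
  have mk' : meets_both G a b (o k') by apply: (meets k' y'); rewrite // kz' yz'.
  by rewrite -kz -kz' root_connect // one_component.
rewrite -[RHS]sum_at_a (partition_big (fun k => fingraph.root r (o k)) predT) //=.
rewrite (bigD1 z) //= [X in _ = _ + X]big1 ?addr0 // => z' zz'; exact: Sz'.
Qed.

End SplitOff.

(* [y] replaces the star of [v] at [a] by trees in the components of
   [G - {a, b}]; their boundaries at the roots are the sums [S z], hence 0. *)
Lemma split_off_edge (i : 'I_n) (a b : 'I_m) (v : 'rV[int]_n) :
  e i = [set a; b] ->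
  (forall x x', meets_both G a b x -> meets_both G a b x' ->
     connect (off_adj G a b) x x') ->
  v \in L -> v 0 i = 0 ->
  exists2 y, y \in L & (forall k, b \in e k -> y 0 k = 0) /\
                       (forall k, a \in e k -> (v - y) 0 k = 0).
Proof.
move=> ei one vL vi; have [o oP] := at_a_end ei.
have S0 := component_sum one vL vi oP; have sum0 := sum_at_a a vL vi.
set r := off_adj G a b in S0 *.
have [P PP] : exists P : 'I_n -> 'rV[int]_n, forall k,
    P k *m D = vertex (o k) - vertex (fingraph.root r (o k)) /\
    forall j, (a \in e j) || (b \in e j) -> P k 0 j = 0.
  apply: (fin_choice (P := fun k (p : 'rV[int]_n) =>
    p *m D = vertex (o k) - vertex (fingraph.root r (o k)) /\
    forall j, (a \in e j) || (b \in e j) -> p 0 j = 0)) => k.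
  have edge u w : r u w -> exists k, e k = [set u; w].
    by case/and3P=> uw _ _; apply: mem_edge_set.
  have [p pD pr] := path_chain edge_sgn sgn_unit edge (connect_root r (o k)).
  exists p; split=> // j; apply: contraTeq => /pr[u [w [/and3P[_ uo wo] ->]]].
  case/andP: uo wo => ua ub /andP[wa wb]; rewrite !inE.
  by rewrite !(eq_sym a) !(eq_sym b) (negPf ua) (negPf ub) (negPf wa) (negPf wb).
pose y : 'rV[int]_n := \sum_(k | (a \in e k) && (k != i))
  v 0 k *: (delta_mx 0 k + sgn a *: P k).
have yE j : (a \in e j) || (b \in e j) ->
    y 0 j = if (a \in e j) && (j != i) then v 0 j else 0.
  move=> jab; rewrite summxE big_mkcond /= (bigD1 j) //= big1 ?addr0.
    by rewrite !mxE !eqxx (PP j).2 // mulr0 addr0 mulr1.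
  move=> k kj; case: ifP => // _.
  by rewrite !mxE eqxx (PP k).2 // eq_sym (negPf kj) mulr0 addr0 mulr0.
exists y; last split.
- rewrite (mem_relation_lattice e sgn_unit); apply/eqP.
  rewrite mulmx_suml.
  have -> : \sum_(k | (a \in e k) && (k != i))
      v 0 k *: (delta_mx 0 k + sgn a *: P k) *m D =
      \sum_(k | (a \in e k) && (k != i))
        v 0 k *: (sgn a *: (vertex a - vertex (fingraph.root r (o k)))).
    apply: eq_bigr => k ak; rewrite -scalemxAl mulmxDl -scalemxAl (PP k).1.
    rewrite (boundary_edge edge_sgn (oP k ak).1) -scalerDr.
    by rewrite addrA subrK.
  apply/rowP => z; rewrite summxE mxE.
  under eq_bigr => k _ do rewrite !mxE eqxx /= !mulrBr.
  rewrite sumrB -mulr_suml sum0 mul0r sub0r; apply/eqP; rewrite oppr_eq0; apply/eqP.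
  transitivity (sgn a * \sum_(k | (a \in e k) && (k != i) &&
      (fingraph.root r (o k) == z)) v 0 k); last by rewrite S0 mulr0.
  rewrite mulr_sumr [RHS]big_mkcondr /=.
  apply: eq_bigr => k _; rewrite (eq_sym z); case: eqP => _ /=; last by rewrite !mulr0.
  by rewrite mulr1 mulrC.
- move=> k bk; rewrite yE ?bk ?orbT //; case: ifP => // /andP[ak ki].
  have [ek /andP[oa ob]] : e k = [set a; o k] /\ off_edge a b (o k).
    by apply: oP; rewrite ak.
  have [ab _] := edge_sgn ei.
  by move: bk; rewrite ek !inE !(eq_sym b) (negPf ab) (negPf ob).
- move=> k ak; rewrite mxE mxE yE ak //=.
  by case: eqVneq => [->|_] /=; rewrite ?vi subrr.
Qed.

Lemma i_separable_separable_by (K : fieldType) (i : 'I_n) :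
  i_separable K L i -> separable_by G (e i).
Proof.
case=> L' [_ [r [[B' basisB'] [B basisB]]] idealL [s [W [WL' _ indW]]]].
apply: NNPP => nsep.
have [a [b ei]] := edge_ends i.
have [GT _ _] := eG.
have abG : adj G a b by rewrite /adj -ei edge_mem_eset.
have one x x' : meets_both G a b x -> meets_both G a b x' ->
    connect (off_adj G a b) x x'.
  move=> mx mx'; apply/negPn/negP => nxx'; apply: nsep; rewrite ei.
  exact: (separable_components abG GT mx mx' nxx').
(* The weight of a monomial is its degree at the vertex [x], which is constant modulo [L]. *)
have weight x u : x \in e i -> u \in L -> (forall k, x \in e k -> u 0 k = 0) ->
    extend0 u \in L'.
  move=> xi uL ux; apply: (fold_weight idealL (d := fun k => x \in e k)) => //.
  - by rewrite xi.
  - by move=> w; apply: incidence0.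
  - by move=> k; rewrite lt0b; apply: ux.
(* Split the fold of [w] into a part vanishing at [b] and one vanishing at [a]. Both lift with new
   coordinate 0, and by injectivity of the fold the lifts add up to [w]. *)
have zero w : w \in L' -> (w *m fold_mx i) 0 i = 0 -> w 0 ord_max = 0.
  move=> wL' wi; have wL := fold_mem idealL wL'.
  have [y yL [yb ya]] := split_off_edge ei one wL wi.
  have y'L : extend0 y \in L' by apply: (weight b); rewrite // ei !inE eqxx orbT.
  have z'L : extend0 (w *m fold_mx i - y) \in L'.
    by apply: (weight a); rewrite ?rpredB // ei !inE eqxx.
  have : w - (extend0 y + extend0 (w *m fold_mx i - y)) = 0.
    apply: (fold_inj idealL basisB basisB'); first by rewrite rpredB ?rpredD.
    apply/rowP => k; rewrite mulmxBl mxE [in X in _ + X]mxE [in X in - X]fold_mxE.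
    rewrite !mxE ?liftK ?unlift_none /=; rewrite !mxE ?liftK ?unlift_none /=.
    by case: (k == i); ring.
  move/rowP/(_ ord_max); rewrite !mxE !unlift_none.
  by rewrite ?addr0 ?oppr0 ?addr0.
(* A linear relation between the two coordinates that holds on [L'] holds on the rows of [W], so it
   is trivial. *)
have dep al be :
    (forall w, w \in L' -> al * w 0 ord_max + be * w 0 (lift ord_max i) = 0) ->
    al = 0 /\ be = 0.
  move=> lin; have := indW (row_mx al%:M be%:M).
  rewrite mul_row_col => /(_ _)/eqP.
  have -> : al%:M *m (col ord_max W)^T + be%:M *m (col (lift ord_max i) W)^T = 0.
    apply/rowP => k; rewrite !mul_scalar_mx !mxE.
    by have := lin _ (WL' k); rewrite !mxE.
  move=> /(_ erefl); rewrite row_mx_eq0 => /andP[/eqP al0 /eqP be0].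
  by move: al0 be0 => /matrixP/(_ 0 0) + /matrixP/(_ 0 0); rewrite !mxE !mulr1n.
have [[w0 [w0L' w0i]]|nw0] :=
  classic (exists w0, w0 \in L' /\ (w0 *m fold_mx i) 0 i != 0).
  set t0 := (w0 *m fold_mx i) 0 i in w0i.
  have scale (k : int) w : w \in L' -> k *: w \in L'.
    by move=> wL'; rewrite -[k]intz scaler_int rpredMz.
  (* The combination of [w] and [w0] whose fold vanishes at [i] has new coordinate 0; expanding the
     fold of [w] at [i] gives these coefficients. *)
  have [w wL'|al0 be0] := dep (t0 - w0 0 ord_max) (- w0 0 ord_max).
    have /zero : t0 *: w - (w *m fold_mx i) 0 i *: w0 \in L' by rewrite rpredB ?scale.
    rewrite mulmxBl -!scalemxAl => zero_w.
    have /zero_w : (t0 *: (w *m fold_mx i) -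
        (w *m fold_mx i) 0 i *: (w0 *m fold_mx i)) 0 i = 0.
      by rewrite /t0; move: (w *m _) (w0 *m _) => u u0; rewrite !mxE mulrC subrr.
    rewrite fold_mxE eqxx mulr1n !mxE.
    by move=> E; rewrite -{}[RHS]E; ring.
  by move: w0i; rewrite -(subrK (w0 0 ord_max) t0) al0 add0r -[w0 0 _]opprK be0 oppr0 eqxx.
(* If all folds vanish at [i], the two coordinates sum to zero on [L']. *)
have [w wL'|] := dep 1 1; last by [].
rewrite !mul1r addrC; apply/eqP; apply: contra_notT nw0 => nw.
by exists w; split=> //; rewrite fold_mxE eqxx mulr1n.
Qed.

End EdgeSeparation.

(** * Ungluing a lattice along a coordinate *)

(** In Smith normal form, [v] is a relation exactly when [v *m P] is supported on the zero rows of
    the diagonal matrix, so the corresponding rows of the inverse of [P] form a basis. *)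
Lemma relation_lattice_basis n m (h : 'M[int]_(n, m)) :
  exists r (B : 'M[int]_(r, n)), lattice_basis (relation_lattice h) B.
Proof.
have [P Pu [Q Qu [d _ hE]]] := int_Smith_normal_form h.
set S := (\matrix_(_, _) _) in hE.
pose J := [set j | row j S == 0].
have memL v : (v \in relation_lattice h) = (v *m P *m S == 0).
  rewrite inE hE !mulmxA; apply/eqP/eqP => [|->]; last by rewrite mul0mx.
  by move/(congr1 (mulmx^~ (invmx Q))); rewrite mulmxK // mul0mx.
have suppJ (u : 'rV_n) : u *m S = 0 <-> forall j, j \notin J -> u 0 j = 0.
  split=> [uS j|uJ].
    rewrite inE => /rV0Pn[k]; rewrite !mxE.
    case: (@eqP _ (j : nat) (k : nat)) => [jk dj|_]; last by rewrite mulr0n eqxx.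
    move/rowP/(_ k): uS; rewrite !mxE (bigD1 j) //= !mxE jk eqxx.
    rewrite big1 => [|l lj]; last first.
      rewrite !mxE -jk; case: eqP => [/val_inj lj'|_]; last by rewrite /= mulr0n mulr0.
      by rewrite lj' eqxx in lj.
    by rewrite addr0 -jk => /eqP; rewrite mulf_eq0 (negPf dj) orbF => /eqP.
  rewrite mulmx_sum_row big1 // => j _.
  have [jJ|/uJ->] := boolP (j \in J); last by rewrite scale0r.
  by move: jJ; rewrite inE => /eqP->; rewrite scaler0.
pose f : 'I_#|J| -> 'I_n := enum_val.
have fE (c : 'rV_#|J|) k : (c *m rowsub f 1%:M) 0 (f k) = c 0 k.
  rewrite mxE (bigD1 k) //= !mxE eqxx mulr1 big1 ?addr0 // => l lk.
  by rewrite !mxE (inj_eq enum_val_inj) (negPf lk) mulr0.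
exists #|J|, (rowsub f (invmx P)).
have BE (c : 'rV_#|J|) : c *m rowsub f (invmx P) = c *m rowsub f 1%:M *m invmx P.
  by rewrite -mulmxA mul_rowsub_mx mul1mx.
split=> [c|v].
  rewrite BE => /(congr1 (mulmx^~ P)); rewrite mulmxKV // mul0mx => /rowP c0.
  by apply/rowP => k; rewrite -fE c0 !mxE.
rewrite memL; split=> [/eqP/suppJ vJ|[c ->]].
  exists (\row_k (v *m P) 0 (f k)); rewrite BE.
  suff -> : (\row_k (v *m P) 0 (f k)) *m rowsub f 1%:M = v *m P by rewrite mulmxK.
  apply/rowP => j; have [jJ|jJ] := boolP (j \in J).
    have fj : f (enum_rank_in jJ j) = j by apply: enum_rankK_in.
    by rewrite -{1}fj fE mxE fj.
  rewrite vJ // mxE big1 // => k _; rewrite !mxE.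
  case: eqP => [kj|_]; last by rewrite mulr0.
  by rewrite -kj enum_valP in jJ.
rewrite BE mulmxKV //; apply/eqP/suppJ => j jJ; rewrite mxE big1 // => k _.
rewrite !mxE; case: eqP => [kj|_]; last by rewrite mulr0.
by rewrite -kj enum_valP in jJ.
Qed.

(** * Minimal generating subfamilies of a finite family *)

Section MinimalGenerators.
Variables (R : comNzRingType) (T : finType) (F : T -> R) (I : R -> Prop).

Definition family_generates (A : {set T}) :=
  forall p, I p <-> ideal_gen (fun g => exists2 t, t \in A & g = F t) p.

Lemma minimal_subfamily A0 : family_generates A0 ->
  exists2 A : {set T}, A \subset A0 & family_generates A /\
    forall A1 : {set T}, A1 \subset A -> family_generates A1 -> A1 = A.
Proof.
have [N] := ubnP #|A0|; elim: N A0 => // N IHN A0 AN genA0.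
have [[A1 [A10 gen1]]|min0] :=
  classic (exists A1 : {set T}, A1 \proper A0 /\ family_generates A1).
  have [|A A1A min1] := IHN A1 _ gen1; first exact: leq_trans (proper_card A10) _.
  by exists A => //; apply: subset_trans A1A (proper_sub A10).
exists A0 => //; split=> // A1 A10 gen1; apply/eqP; rewrite eqEproper A10 /=.
by apply/negP => A1p; apply: min0; exists A1.
Qed.

Lemma generates_enum (A : {set T}) (B : {set 'I_#|A|}) :
  generates (fun k : 'I_#|A| => F (enum_val k)) B I <->
  family_generates [set enum_val k | k in B].
Proof.
have E p : ideal_gen (fun g => exists2 k, k \in B & g = F (enum_val k)) p <->
    ideal_gen (fun g => exists2 t, t \in [set enum_val k | k in B] & g = F t) p.
  split; apply: ideal_gen_sub => g.
    by case=> k kB ->; apply: ideal_gen_mem; exists (enum_val k); rewrite ?imset_f.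
  by case=> t /imsetP[k kB ->] ->; apply: ideal_gen_mem; exists k.
by split=> gen p; split=> [/gen/E|/E/gen].
Qed.

End MinimalGenerators.

Definition move_max n (i : 'I_n) (v : 'rV[int]_n) : 'rV[int]_n.+1 :=
  \row_j (if unlift ord_max j is Some k then (if k == i then 0 else v 0 k)
          else v 0 i).

(** Two sections of [foldm]: all powers of the variable [i] stay on the old copy, or all move to the
    new one. They lift moves along the first and the second side. *)
Lemma foldm_lift n (i : 'I_n) :
  exists f g : 'X_{1..n} -> 'X_{1..n.+1},
  [/\ forall p, foldm i (f p) = p /\ foldm i (g p) = p,
      forall p q, mdiff (f p) (f q) = extend0 (mdiff p q) &
      forall p q, mdiff (g p) (g q) = move_max i (mdiff p q)].
Proof.
exists (fun p => [multinom if unlift ord_max j is Some k then p k else 0%N | j < n.+1]).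
exists (fun p => [multinom if unlift ord_max j is Some k
                           then (if k == i then 0%N else p k) else p i | j < n.+1]).
split=> [q|q u|q u].
- split; apply/mnmP => k; rewrite !mnmE liftK unlift_none ?addn0 //.
  by case: eqP => [->|_]; rewrite ?muln1 ?muln0 ?addn0.
- by apply/rowP => j; rewrite !mxE !mnmE; case: unliftP => [k|] _; rewrite ?mxE.
- apply/rowP => j; rewrite !mxE !mnmE; case: unliftP => [k|] _; rewrite ?mxE //.
  by case: eqP.
Qed.

Section Unglue.
Variables (K : fieldType) (n m : nat) (h : 'M[int]_(n, m)) (i : 'I_n).
Variable B : pred 'I_n.
Local Notation L := (relation_lattice h).

Hypothesis Bi : B i.
Hypothesis splitL : forall v, v \in L -> exists v1 v2 : 'rV[int]_n,
  [/\ v = v1 + v2, v1 \in L, v2 \in L, forall k, ~~ B k -> v1 0 k = 0 &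
      forall k, B k -> k != i -> v2 0 k = 0].
Hypothesis no_unit : forall v, v \in L -> (forall k, k != i -> v 0 k = 0) -> v = 0.
Hypothesis conformalL : forall v, v \in L -> v != 0 -> exists c,
  [/\ c \in L, c != 0 & forall k,
      [\/ c 0 k = 0, c 0 k = 1 /\ 0 < v 0 k | c 0 k = -1 /\ v 0 k < 0]].
Hypothesis side1 : exists v, [/\ v \in L, v 0 i != 0 & forall k, ~~ B k -> v 0 k = 0].
Hypothesis side2 : exists v,
  [/\ v \in L, v 0 i != 0 & forall k, B k -> k != i -> v 0 k = 0].

(* The unglued lattice: the new coordinate takes the place of [i] outside [B]. *)
Definition part1_mx : 'M[int]_(n.+1, n) :=
  \matrix_(j < n.+1, k < n) ((j == lift ord_max k) && B k)%:R.
Definition part2_mx : 'M[int]_(n.+1, n) :=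
  \matrix_(j < n.+1, k < n) (if k == i then j == ord_max
                  else (j == lift ord_max k) && ~~ B k)%:R.
Definition unglued := row_mx (part1_mx *m h) (part2_mx *m h).
Local Notation L' := (relation_lattice unglued).

Implicit Types (v : 'rV[int]_n) (w : 'rV[int]_n.+1).

Lemma part1E w k : (w *m part1_mx) 0 k = if B k then w 0 (lift ord_max k) else 0.
Proof.
rewrite mxE (bigD1 (lift ord_max k)) //= mxE eqxx big1 ?addr0 => [|j /negPf jk].
  by case: (B k); rewrite ?mulr1 ?mulr0.
by rewrite mxE jk mulr0.
Qed.

Lemma part2E w k : (w *m part2_mx) 0 k =
  if k == i then w 0 ord_max else if B k then 0 else w 0 (lift ord_max k).
Proof.
rewrite mxE; case: (eqVneq k i) => [ki|ki].
  rewrite (bigD1 ord_max) //= mxE ki !eqxx mulr1 big1 ?addr0 // => j /negPf jk.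
  by rewrite mxE eqxx jk mulr0.
rewrite (bigD1 (lift ord_max k)) //= mxE (negPf ki) eqxx big1 ?addr0 => [|j /negPf jk].
  by case: (B k); rewrite ?mulr1 ?mulr0.
by rewrite mxE (negPf ki) jk mulr0.
Qed.

Lemma mem_unglued w : (w \in L') = (w *m part1_mx \in L) && (w *m part2_mx \in L).
Proof. by rewrite !inE mul_mx_row row_mx_eq0 !mulmxA. Qed.

Lemma fold_parts w : w *m fold_mx i = w *m part1_mx + w *m part2_mx.
Proof.
apply/rowP => k; rewrite fold_mxE mxE part1E part2E.
by case: (eqVneq k i) => [->|_]; rewrite ?Bi //; case: (B k); rewrite ?addr0 ?add0r.
Qed.

Lemma extend0_mem v : v \in L -> (forall k, ~~ B k -> v 0 k = 0) -> extend0 v \in L'.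
Proof.
move=> vL vB; rewrite mem_unglued.
have -> : extend0 v *m part1_mx = v.
  by apply/rowP => k; rewrite part1E extend0_lift; case: ifPn => // /vB.
rewrite vL (_ : _ *m part2_mx = 0) ?rpred0 //.
apply/rowP => k; rewrite part2E extend0_lift extend0_max mxE.
by case: eqP => // _; case: ifPn => // /vB.
Qed.

Lemma move_max_mem v : v \in L -> (forall k, B k -> k != i -> v 0 k = 0) ->
  move_max i v \in L'.
Proof.
move=> vL vB; rewrite mem_unglued.
have -> : move_max i v *m part2_mx = v.
  apply/rowP => k; rewrite part2E !mxE liftK unlift_none.
  by case: eqVneq => [->|ki] //; case: ifPn => // /vB->.
rewrite vL (_ : _ *m part1_mx = 0) ?rpred0 //.
apply/rowP => k; rewrite part1E !mxE liftK.
by case: ifPn => // Bk; case: eqVneq => // /vB->.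
Qed.

(** A zero fold leaves only entries at the two copies of [i], so both parts of [w] are supported at
    [i] and vanish by [no_unit]. *)
Lemma unglued_fold_inj w : w \in L' -> w *m fold_mx i = 0 -> w = 0.
Proof.
rewrite mem_unglued fold_parts => /andP[w1 w2] /rowP w0.
have wk k : k != i -> w 0 (lift ord_max k) = 0.
  move=> ki; have := w0 k; rewrite mxE part1E part2E (negPf ki) mxE.
  by case: (B k); rewrite ?addr0 ?add0r.
have /rowP/(_ i) : w *m part1_mx = 0.
  by apply: no_unit => // k ki; rewrite part1E wk // if_same.
have /rowP/(_ i) : w *m part2_mx = 0.
  by apply: no_unit => // k ki; rewrite part2E (negPf ki) wk // if_same.
rewrite part1E part2E eqxx Bi !mxE => wm wi.
apply: row_lift_eq => [k|]; rewrite ?mxE //.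
by have [->|/wk] := eqVneq k i.
Qed.

Lemma unglued_fold_surj v : v \in L -> exists w, w \in L' /\ v = w *m fold_mx i.
Proof.
move=> /splitL[v1 [v2 [-> v1L v2L v1B v2B]]].
exists (extend0 v1 + move_max i v2); split.
  by rewrite rpredD ?extend0_mem ?move_max_mem.
apply/rowP => k; rewrite fold_mxE !mxE !liftK !unlift_none.
by case: eqVneq => [->|_]; rewrite /= ?mulr1n ?mulr0n; ring.
Qed.

(** The fold maps [L'] bijectively onto [L], so a basis of [L] lifts row by row. *)
Lemma unglued_rank : exists r, lattice_rank L' r /\ lattice_rank L r.
Proof.
have [r [A [indA genA]]] := relation_lattice_basis h.
exists r; split; last by exists A.
have [W WP] : exists W : 'I_r -> 'rV_n.+1,
    forall k, W k \in L' /\ row k A = W k *m fold_mx i.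
  apply: (fin_choice (P := fun k w => w \in L' /\ row k A = w *m fold_mx i)) => k.
  by apply/unglued_fold_surj/genA; exists (delta_mx 0 k); rewrite rowE.
pose A' := \matrix_k W k.
have A'E : A' *m fold_mx i = A.
  by apply/row_matrixP => k; rewrite row_mul rowK (WP k).2.
have memA' c : c *m A' \in L'.
  rewrite mulmx_sum_row rpred_sum // => k _.
  by rewrite rowK -[c 0 k]intz scaler_int rpredMz // (WP k).1.
exists A'; split=> [c cA'|w]; first by apply: indA; rewrite -A'E mulmxA cA' mul0mx.
split=> [wL'|[c ->]//].
have /genA[c cE] : w *m fold_mx i \in L.
  by move: wL'; rewrite mem_unglued fold_parts => /andP[? ?]; rewrite rpredD.
exists c; apply/eqP; rewrite -subr_eq0; apply/eqP/unglued_fold_inj.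
  by rewrite rpredB.
by rewrite mulmxBl -mulmxA A'E cE subrr.
Qed.

Lemma identify_unglued (p : {mpoly K[n]}) : lattice_ideal K L p <->
  exists2 q, lattice_ideal K L' q & identify i q = p.
Proof.
split=> [[s [sL ->]]|[_ [s [sL ->]] <-]]; last first.
  rewrite raddf_sum big_seq.
  apply: (big_ind (lattice_ideal K L)); [exact: ideal_gen0|exact: ideal_genD|].
  move=> u /sL[w wL' uE] /=; rewrite rmorphM; apply: ideal_genM.
  rewrite uE lattice_binomialE raddfB /= !identifyX; apply: mem_lattice_ideal.
  rewrite mdiff_foldm mdiff_posm_negm.
  by move: wL'; rewrite mem_unglued fold_parts => /andP[? ?]; rewrite rpredD.
rewrite big_seq; apply: (big_ind (fun p : {mpoly K[n]} =>
  exists2 q, lattice_ideal K L' q & identify i q = p)).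
- by exists 0; rewrite ?raddf0 //; apply: ideal_gen0.
- move=> _ _ [p' pI <-] [q' qI <-]; exists (p' + q'); last by rewrite raddfD.
  exact: ideal_genD.
move=> u /sL[v vL ->].
suff [q qI qE] : exists2 q, lattice_ideal K L' q & identify i q = lattice_binomial K v.
  have [g gE] := identify_surj i u.1; exists (g * q); first exact: ideal_genM.
  by rewrite rmorphM /= gE qE.
have [f [g [fgK fE gE]]] := foldm_lift i.
pose image (p1 p2 : 'X_{1..n}) :=
  exists2 q, lattice_ideal K L' q & identify i q = 'X_[p1] - 'X_[p2].
(* Pass from [posm v] to [negm v] through [t], the exponent [posm v - v1]. It is nonnegative away
   from [i] since there [v1] is 0 or agrees with [v], and at [i] by assumption. *)
have chain (v1 v2 : 'rV[int]_n) : v = v1 + v2 ->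
    (forall k, k != i -> v1 0 k = 0 \/ v2 0 k = 0) ->
    v1 0 i <= (posm v i)%:Z -> (forall p1 p2, mdiff p1 p2 = v1 -> image p1 p2) ->
    (forall p1 p2, mdiff p1 p2 = v2 -> image p1 p2) -> image (posm v) (negm v).
  move=> /rowP vE off le1 im1 im2.
  have ge0 k : 0 <= (posm v k)%:Z - v1 0 k.
    have [->|/off] := eqVneq k i; first by lia.
    by rewrite mnmE vE mxE; move: (v1 0 k) (v2 0 k) => x y; case: ifP; lia.
  pose t := [multinom absz ((posm v k)%:Z - v1 0 k)%R | k < n].
  have tE k : (t k)%:Z = (posm v k)%:Z - v1 0 k by rewrite mnmE gez0_abs ?ge0.
  have [|q1 q1I q1E] := im1 (posm v) t.
    by apply/rowP => k; rewrite mxE tE opprB addrC subrK.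
  have [|q2 q2I q2E] := im2 t (negm v).
    have /rowP vpn := mdiff_posm_negm v; apply/rowP => k; have := vpn k.
    by rewrite mxE vE mxE => E; rewrite mxE tE addrAC E addrC addKr.
  exists (q1 + q2); first exact: ideal_genD.
  by rewrite raddfD /= q1E q2E addrA subrK.
have [v1 [v2 [vE v1L v2L v1B v2B]]] := splitL vL.
have image1 p1 p2 : mdiff p1 p2 = v1 -> image p1 p2.
  move=> pv; exists ('X_[f p1] - 'X_[f p2]).
    by apply: mem_lattice_ideal; rewrite fE pv extend0_mem.
  by rewrite raddfB /= !identifyX !(fgK _).1.
have image2 p1 p2 : mdiff p1 p2 = v2 -> image p1 p2.
  move=> pv; exists ('X_[g p1] - 'X_[g p2]).
    by apply: mem_lattice_ideal; rewrite gE pv move_max_mem.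
  by rewrite raddfB /= !identifyX !(fgK _).2.
have off k : k != i -> v1 0 k = 0 \/ v2 0 k = 0.
  by move=> ki; have [Bk|/v1B] := boolP (B k); [right; apply: v2B|left].
rewrite lattice_binomialE.
(* At least one of the two moves leads from [posm v] to a monomial. *)
have [le1|le2] : v1 0 i <= (posm v i)%:Z \/ v2 0 i <= (posm v i)%:Z.
- by rewrite mnmE vE mxE; move: (v1 0 i) (v2 0 i) => x y; case: ifP; lia.
- exact: (chain v1 v2).
- by apply: (chain v2 v1); rewrite // 1?addrC // => k /off; case; [right|left].
Qed.

(** Vectors with entries 0, 1, -1 are coded by a finite type, so that a minimal generating subfamily
    can be extracted. *)
Definition unit_vector (f : {ffun 'I_n.+1 -> 'I_3}) : 'rV[int]_n.+1 :=
  \row_j ((f j)%:Z - 1).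

Definition one_sided f := (unit_vector f \in L') &&
  ((unit_vector f 0 ord_max == 0) || (unit_vector f 0 (lift ord_max i) == 0)).

Lemma unit_vectorP (w : 'rV[int]_n.+1) :
  (forall j, [\/ w 0 j = 0, w 0 j = 1 | w 0 j = -1]) -> exists f, unit_vector f = w.
Proof.
move=> wu; exists [ffun j => inord (absz (w 0 j + 1))].
apply/rowP => j; rewrite mxE ffunE inordK; by case: (wu j) => ->.
Qed.

(** Take a conformal cycle in a nonzero part of [w] and lift it with [extend0] or [move_max],
    according to the part. *)
Lemma conformal_one_sided w : w \in L' -> w != 0 -> exists f,
  [/\ one_sided f, unit_vector f != 0 & forall j,
      [\/ unit_vector f 0 j = 0, unit_vector f 0 j = 1 /\ 0 < w 0 j
        | unit_vector f 0 j = -1 /\ w 0 j < 0]].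
Proof.
move=> wL' w0; have := wL'; rewrite mem_unglued => /andP[w1 w2].
suff [c [cL' c0 cw c1]] : exists c : 'rV[int]_n.+1, [/\ c \in L', c != 0,
    forall j, [\/ c 0 j = 0, c 0 j = 1 /\ 0 < w 0 j | c 0 j = -1 /\ w 0 j < 0] &
    (c 0 ord_max == 0) || (c 0 (lift ord_max i) == 0)].
  have [|f fE] := @unit_vectorP c.
    by move=> j; case: (cw j) => [->|[-> _]|[-> _]]; [apply: Or31|apply: Or32|apply: Or33].
  by exists f; rewrite /one_sided fE; split=> //; apply/andP.
have [w10|/(conformalL w1)[c [cL c0 cw]]] := eqVneq (w *m part1_mx) 0; last first.
  have cB k : ~~ B k -> c 0 k = 0.
    by have := cw k; rewrite part1E => + /negPf Bk; rewrite Bk; case=> // -[].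
  exists (extend0 c); split.
  - exact: extend0_mem.
  - have /rV0Pn[k ck] := c0; apply/rV0Pn; exists (lift ord_max k).
    by rewrite extend0_lift.
  - move=> j; case: (unliftP ord_max j) => [k|] ->.
      rewrite extend0_lift; have := cw k; rewrite part1E.
      by case: ifPn => // /cB-> _; apply: Or31.
    by rewrite extend0_max; apply: Or31.
  - by rewrite extend0_max eqxx.
have w20 : w *m part2_mx != 0.
  apply: contraNneq w0 => w20; apply/eqP/unglued_fold_inj => //.
  by rewrite fold_parts w10 w20 addr0.
have [c [cL c0 cw]] := conformalL w2 w20.
have cB k : B k -> k != i -> c 0 k = 0.
  by move=> Bk /negPf ki; have := cw k; rewrite part2E Bk ki; case=> // -[].
exists (move_max i c); split.
- exact: move_max_mem.
- have /rV0Pn[k ck] := c0; apply/rV0Pn.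
  have [ki|ki] := eqVneq k i; first by exists ord_max; rewrite mxE unlift_none -ki.
  by exists (lift ord_max k); rewrite mxE liftK (negPf ki).
- move=> j; case: (unliftP ord_max j) => [k|] ->; rewrite mxE ?liftK ?unlift_none.
    have := cw k; rewrite part2E; case: eqVneq => [_ _|ki]; first exact: Or31.
    by case: ifP => // /cB->; rewrite // => _; apply: Or31.
  by have := cw i; rewrite part2E eqxx.
- by rewrite !mxE liftK eqxx orbT.
Qed.

Let F f := lattice_binomial K (unit_vector f).

(** Induction on the sum of absolute values. For [c] conformal to [w], the positive and negative
    parts of [w] are those of [c] plus those of [w - c], so the binomial of [w] is a combination of
    theirs. *)
Lemma one_sided_generates :
  family_generates F (lattice_ideal K L') [set f | one_sided f].
Proof.
have F_mem f : one_sided f -> lattice_ideal K L' (F f).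
  by case/andP=> fL' _; apply: ideal_gen_mem; exists (unit_vector f).
move=> p; split; last first.
  by apply: ideal_gen_sub => _ [f + ->]; rewrite inE; apply: F_mem.
apply: ideal_gen_sub => _ [w wL' ->].
pose size (u : 'rV[int]_n.+1) := (\sum_j absz (u 0%R j))%N.
have [N] := ubnP (size w); elim: N w wL' => // N IHN w wL' wN.
have [->|w0] := eqVneq w 0.
  rewrite lattice_binomialE (_ : posm 0 = negm 0) ?subrr; first exact: ideal_gen0.
  by apply/mnmP => j; rewrite !mnmE mxE.
have [f [fone f0 fw]] := conformal_one_sided wL' w0.
have [c cE] : exists c, c = unit_vector f by exists (unit_vector f).
rewrite -cE in f0 fw; have cL' : c \in L' by rewrite cE; case/andP: fone.
have posD : posm w = (posm c + posm (w - c))%MM.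
  apply/mnmP => j; rewrite mnmDE !mnmE !mxE.
  move: (c 0 j) (w 0 j) (fw j) => x y.
  by case=> [->|[-> ?]|[-> ?]] /=; do ![case: ifP]; lia.
have negD : negm w = (negm c + negm (w - c))%MM.
  apply/mnmP => j; rewrite mnmDE !mnmE !mxE.
  move: (c 0 j) (w 0 j) (fw j) => x y.
  by case=> [->|[-> ?]|[-> ?]] /=; do ![case: ifP]; lia.
have -> : lattice_binomial K w = 'X_[posm (w - c)] * F f
    + 'X_[negm c] * lattice_binomial K (w - c).
  rewrite /F -cE !lattice_binomialE posD negD !mpolyXD; ring.
apply: ideal_genD; apply: ideal_genM.
  by apply: ideal_gen_mem; exists f; rewrite ?inE.
apply: IHN; first by rewrite rpredB.
have /rV0Pn[j cj] := f0; rewrite ltnS in wN; apply: leq_trans wN; rewrite /size.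
rewrite (bigD1 j) // [X in (_ < X)%N](bigD1 j) //= -addSn leq_add //.
  rewrite !mxE; move: (c 0 j) (w 0 j) (fw j) cj => x y.
  by case=> [->|[-> ?]|[-> ?]]; lia.
apply: leq_sum => k _; rewrite !mxE.
by move: (c 0 k) (w 0 k) (fw k) => x y [->|[-> ?]|[-> ?]]; lia.
Qed.

(* The degree in the variable [j] is constant on the classes of monomials
   modulo binomials not involving [j]. *)
Lemma generators_involve A j w : family_generates F (lattice_ideal K L') A ->
  w \in L' -> w 0 j != 0 -> exists2 f, f \in A & unit_vector f 0 j != 0.
Proof.
move=> genA wL' wj; apply: NNPP => nA.
have Aj f : f \in A -> unit_vector f 0 j = 0.
  by move=> fA; apply/eqP/negPn/negP => fj; apply: nA; exists f.
have : lattice_ideal K L' ('X_[posm w] - 'X_[negm w]).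
  by apply: mem_lattice_ideal; rewrite mdiff_posm_negm.
move=> /genA gw; have : negm w j = posm w j.
  apply: (binomial_class (C := fun p => p j = posm w j) _ gw) => // _ [f fA ->].
  exists (posm (unit_vector f)), (negm (unit_vector f)).
  by rewrite /F lattice_binomialE; split=> // u; rewrite !mnmDE !mnmE Aj.
by rewrite !mnmE; move: (w 0 j) wj => x; do 2![case: ifP]; lia.
Qed.

(** By [generators_involve] some generator uses the old copy of [i] and some generator the new one.
    Being one-sided, each vanishes at the other copy, so the two form a nonzero diagonal minor. *)
Lemma unglued_generators : exists s (W : 'M[int]_(s, n.+1)),
  [/\ forall k, row k W \in L',
      minimal_generators (fun k => lattice_binomial K (row k W))
        (lattice_ideal K L') &
      rows_independent (col_mx (col ord_max W)^T (col (lift ord_max i) W)^T)].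
Proof.
have [A Aone [genA minA]] := minimal_subfamily one_sided_generates.
pose W := \matrix_(k < #|A|) unit_vector (enum_val k).
exists #|A|, W.
have AP f : f \in A -> one_sided f by move/(subsetP Aone); rewrite inE.
have rowW k : row k W = unit_vector (enum_val k) by rewrite rowK.
have genW X : generates (fun k => lattice_binomial K (row k W)) X (lattice_ideal K L') <->
    family_generates F (lattice_ideal K L') [set enum_val k | k in X].
  rewrite -generates_enum; split=> gen p; rewrite gen; split;
    by apply: ideal_gen_sub => _ [k kX ->]; apply: ideal_gen_mem; exists k; rewrite ?rowW.
have imT : [set enum_val k | k in [set: 'I_#|A|]] = A.
  apply/setP => f; apply/imsetP/idP => [[k _ ->]|fA]; first exact: enum_valP.
  by exists (enum_rank_in fA f); rewrite ?inE // enum_rankK_in.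
split.
- by move=> k; rewrite rowW; case/andP: (AP _ (enum_valP k)).
- split; first by rewrite genW imT.
  move=> X /genW genX; have imX : [set enum_val k | k in X] = A.
    by apply: minA genX; apply/subsetP => _ /imsetP[k _ ->]; apply: enum_valP.
  by apply: (imset_inj enum_val_inj); rewrite imX imT.
have witness j w : w \in L' -> w 0 j != 0 -> exists k, W k j != 0 /\
    ((W k ord_max == 0) || (W k (lift ord_max i) == 0)).
  move=> wL' wj; have [f fA fj] := generators_involve genA wL' wj.
  exists (enum_rank_in fA f); rewrite !mxE !enum_rankK_in //.
  by move: fj (AP _ fA); rewrite /one_sided !mxE => -> /andP[_ ->].
have [k1 [W1 W1']] : exists k, W k (lift ord_max i) != 0 /\
    ((W k ord_max == 0) || (W k (lift ord_max i) == 0)).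
  have [v [vL vi vB]] := side1; apply: (witness _ (extend0 v)); first exact: extend0_mem.
  by rewrite extend0_lift.
have [k2 [W2 W2']] : exists k, W k ord_max != 0 /\
    ((W k ord_max == 0) || (W k (lift ord_max i) == 0)).
  have [v [vL vi vB]] := side2.
  apply: (witness _ (move_max i v)); first exact: move_max_mem.
  by rewrite mxE unlift_none.
rewrite (negPf W1) orbF in W1'; rewrite (negPf W2) /= in W2'.
move=> c; rewrite -[c]hsubmxK mul_row_col => /rowP c0.
have lin k : lsubmx c 0 0 * W k ord_max + rsubmx c 0 0 * W k (lift ord_max i) = 0.
  have := c0 k; rewrite !mxE !big_ord1 !mxE; exact.
have lc0 : lsubmx c 0 0 = 0.
  have := lin k2; rewrite (eqP W2') mulr0 addr0 => /eqP.
  by rewrite mulf_eq0 (negPf W2) orbF => /eqP.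
have rc0 : rsubmx c 0 0 = 0.
  have := lin k1; rewrite (eqP W1') mulr0 add0r => /eqP.
  by rewrite mulf_eq0 (negPf W1) orbF => /eqP.
rewrite [lsubmx c]mx11_scalar [rsubmx c]mx11_scalar lc0 rc0.
by rewrite !raddf0 row_mx0.
Qed.

Lemma unglued_i_separable : i_separable K L i.
Proof.
exists (relation_lattice unglued : zmodClosed 'rV[int]_n.+1); split.
(* [L'] is again the kernel of an integer matrix, hence saturated. *)
- exact: relation_lattice_saturated.
- exact: unglued_rank.
- exact: identify_unglued.
- exact: unglued_generators.
Qed.

End Unglue.

(** * Separations of the graph separate the lattice *)

Section GraphToLattice.
Variables (m n : nat) (G : sgraph 'I_m) (e : 'I_n -> {set 'I_m}).
Hypothesis eG : edge_enumeration G e.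
Variable sgn : 'I_m -> int.
Hypothesis edge_ends : forall k, exists x y, e k = [set x; y].
Hypothesis edge_sgn : forall k x y, e k = [set x; y] -> x != y /\ sgn y = - sgn x.
Hypothesis sgn_unit : forall x, sgn x = 1 \/ sgn x = -1.

Local Notation D := (boundary_mx e sgn).
Local Notation L := (relation_lattice (edge_vectors e)).

(** Close the path around the cycle with the edge [i]; since the path avoids it, the entry at [i] is
    a sign. *)
Lemma internal_relation (H : sgraph 'I_m) i :
  eset H \subset eset G -> internal H (e i) -> exists v,
    [/\ v \in L, v 0 i != 0 & forall k, v 0 k != 0 -> e k \in eset H].
Proof.
move=> HG iH; have [x [y [ei yx]]] := connect_internal iH.
have iHe : e i \in eset H.
  case: iH => c [_ /andP[cH cU] [z zc ->]]; exact: next_cycle cH zc.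
have edge u w : adj H u w && ([set u; w] != e i) -> exists k, e k = [set u; w].
  by case/andP=> /(subsetP HG) uw _; apply: mem_edge_set eG _ uw.
have [P PD PH] := path_chain edge_sgn sgn_unit edge yx.
have Pi : P 0 i = 0.
  by apply/eqP/negPn/negP => /PH[u [w [/andP[_ uw] eiE]]]; rewrite eiE eqxx in uw.
exists (P + sgn x *: delta_mx 0 i); split.
- rewrite (mem_relation_lattice e sgn_unit) mulmxDl PD -scalemxAl.
  rewrite (boundary_edge edge_sgn ei) scalerA (sgn2 sgn_unit) scale1r.
  by rewrite addrA subrK subrr.
- by rewrite !mxE Pi !eqxx add0r mulr1; case: (sgn_unit x) => ->.
- move=> k; rewrite !mxE eqxx /=; case: (eqVneq k i) => [->//|_].
  by rewrite mulr0 addr0 => /PH[u [w [/andP[uw _] ->]]].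
Qed.

Section Separation.
Variables (i : 'I_n) (G1 G2 : sgraph 'I_m).
Hypotheses (EI : eset G1 :&: eset G2 = [set e i]) (VI : vset G1 :&: vset G2 = e i).
Hypothesis EU : eset G = eset G1 :|: eset G2.

Lemma edge_vset (H : sgraph 'I_m) k x : e k \in eset H -> x \in e k -> x \in vset H.
Proof. by move=> /esetP/andP[/subsetP kH _] /kH. Qed.

(* Off the ends [a], [b] of the separating edge, [u] has the same boundary as
   [v] or none; the boundary values at [a] and [b] are opposite, so a multiple
   of the separating edge cancels both. *)
Lemma separation_split v : v \in L -> exists v1 v2,
  [/\ v = v1 + v2, v1 \in L, v2 \in L, forall k, e k \notin eset G1 -> v1 0 k = 0 &
      forall k, e k \in eset G1 -> k != i -> v2 0 k = 0].
Proof.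
move=> vL; have [a [b ei]] := edge_ends i; have [ab _] := edge_sgn ei.
have i1 : e i \in eset G1 by have := set11 (e i); rewrite -EI inE => /andP[].
pose u : 'rV[int]_n := \row_k (if (e k \in eset G1) && (k != i) then v 0 k else 0).
have bdE (w : 'rV[int]_n) x :
    (w *m D) 0 x = \sum_k w 0 k * (sgn x *+ (x \in e k)).
  by rewrite mxE; apply: eq_bigr => k _; rewrite mxE.
have u_off x : x \notin e i -> (u *m D) 0 x = 0.
  move=> xi; have [x1|x1] := boolP (x \in vset G1).
    rewrite bdE -[RHS](boundary0 sgn_unit x vL); apply: eq_bigr => k _.
    have [xk|_] := boolP (x \in e k); last by rewrite !mulr0n !mulr0.
    rewrite mxE; have -> : k != i by apply: contraNneq xi => <-.
    suff -> : e k \in eset G1 by [].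
    have := edge_mem_eset eG k; rewrite EU inE => /orP[//|k2].
    by move: xi; rewrite -VI inE x1 (edge_vset k2 xk).
  rewrite bdE big1 // => k _; rewrite mxE.
  case: ifP => [/andP[k1 _]|_]; last by rewrite mul0r.
  have [xk|_] := boolP (x \in e k); last by rewrite mulr0n mulr0.
  by rewrite (edge_vset k1 xk) in x1.
pose al := (u *m D) 0 a.
have uD : u *m D = al *: (vertex a - vertex b).
  have sum0 : \sum_(x in [set: 'I_m]) (u *m D) 0 x = 0.
    rewrite (sum_boundary e sgn) big1 // => k _; have [x [y ek]] := edge_ends k.
    by rewrite (sum_sgn edge_sgn _ ek) !inE subrr !mulr0.
  have bE : (u *m D) 0 b = - al.
    apply/eqP; rewrite -addr_eq0 addrC; apply/eqP; rewrite -[RHS]sum0.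
    rewrite (bigD1 a) ?inE //= (bigD1 b) ?inE 1?eq_sym //= big1 ?addr0 // => x.
    by case/andP=> /andP[_ xa] xb; rewrite u_off // ei !inE negb_or xa.
  apply/rowP => x.
  have -> : (al *: (vertex a - vertex b)) 0 x = al * ((x == a)%:R - (x == b)%:R).
    by rewrite !mxE eqxx.
  case: (eqVneq x a) => [->|xa]; first by rewrite (negPf ab) subr0 mulr1.
  case: (eqVneq x b) => [->|xb]; first by rewrite bE sub0r mulrN1.
  by rewrite subrr mulr0 u_off // ei !inE negb_or xa.
pose v1 := u - (al * sgn a) *: delta_mx 0 i.
have v1L : v1 \in L.
  rewrite (mem_relation_lattice e sgn_unit) mulmxBl uD -scalemxAl.
  rewrite (boundary_edge edge_sgn ei) scalerA -mulrA (sgn2 sgn_unit) mulr1.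
  by rewrite subrr.
exists v1, (v - v1); split=> //; first by rewrite addrC subrK.
- exact: rpredB.
- move=> k k1; rewrite !mxE (negPf k1) eqxx /=; case: eqVneq => [ki|_].
    by rewrite ki i1 in k1.
  by rewrite mulr0 subr0.
- by move=> k k1 ki; rewrite !mxE k1 (negPf ki) eqxx /= mulr0 subr0 subrr.
Qed.

End Separation.

Lemma separable_by_i_separable (K : fieldType) i :
  separable_by G (e i) -> i_separable K L i.
Proof.
case=> G1 [G2 [[[_ E1] [_ E2] _ _] [EI VI] [EU _] [int1 int2]]].
have inj_e : injective e by case: eG.
have memI k : (e k \in eset G1) && (e k \in eset G2) = (k == i).
  by rewrite -in_setI EI inE (inj_eq inj_e).
have /andP[i1 i2] : (e i \in eset G1) && (e i \in eset G2) by rewrite memI.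
(* The first side consists of the edges of [G1], including [e i]. *)
apply: (@unglued_i_separable K n m (edge_vectors e) i (fun k => e k \in eset G1)) => //.
- exact: separation_split EI VI EU.
- move=> v vL vi; apply/rowP => k; rewrite mxE.
  have [->|/vi//] := eqVneq k i; have [a [b ei]] := edge_ends i.
  have := incidence0 sgn_unit a vL; rewrite (bigD1 i) //= ei !inE eqxx mulr1.
  by rewrite big1 ?addr0 // => j /vi->; rewrite mul0r.
- exact: conformal_cycle edge_ends edge_sgn sgn_unit.
- have [v [vL vi v1]] := internal_relation E1 int1; exists v; split=> // k k1.
  by apply/eqP; apply: contraNT k1 => /v1.
- have [v [vL vi v2]] := internal_relation E2 int2; exists v; split=> // k k1 ki.
  apply/eqP; apply: contraNT ki => /v2 k2; by rewrite -memI k1.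
Qed.

End GraphToLattice.

Theorem corollary5p6 (K : fieldType) (charK : [pchar K]%R =i pred0)
    (m n : nat) (G : sgraph 'I_m) (e : 'I_n -> {set 'I_m})
    (eG : edge_enumeration G e) (bipG : bipartite G) :
  edge_ring_inseparable K e <-> graph_inseparable G.
Proof.
have [sgn [edge_ends edge_sgn sgn_unit]] := bipartite_sgn eG bipG.
split=> insep.
  move=> f fG sep; have [i ef] := mem_edge_set eG fG.
  apply: (insep i); apply: (separable_by_i_separable eG edge_ends edge_sgn sgn_unit).
  by rewrite ef.
move=> i /(i_separable_separable_by eG edge_ends edge_sgn sgn_unit).
exact: insep (edge_mem_eset eG i).
Qed.
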